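(* Let $\gamma_t(x)$ be a $C^\infty$ function defined on a neighborhood of $(0,0)$ in $\mathbb{R}^N\times\mathbb{R}^n$ with values in $\mathbb{R}^n$ and $\gamma_0(x)\equiv x$. Then: (i) every element $(Z,d)$ of $\mathcal{L}(\mathcal P\cup\mathcal N)$ has $Z$ equal to a linear combination with constant coefficients of vector fields of elements of $\mathcal{L}(\widehat{\mathcal P}\cup\widehat{\mathcal N})$ with the same degree $d$, and every element of $\mathcal L(\mathcal P)$ is likewise a constant-coefficient linear combination of elements of $\mathcal L(\widehat{\mathcal P})$ with the same degree; (ii) every element of $\mathcal{L}(\widehat{\mathcal P}\cup\widehat{\mathcal N})$ is a constant-coefficient linear combination of elements of $\mathcal{L}(\mathcal P\cup\mathcal N)$ with the same degree, and every element of $\mathcal L(\widehat{\mathcal P})$ is a constant-coefficient linear combination of elements of $\mathcal L(\mathcal P)$ with the same degree.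
   Context: Fix $e=\{e_1,\dots,e_N\}\subseteq[0,\infty)^\nu$ (each $e_i$ has a nonzero component; for each $\mu$ some $e_i^\mu\ne0$). $W(t,x)=\frac{d}{d\epsilon}|_{\epsilon=1}\gamma_{\epsilon t}\circ\gamma_t^{-1}(x)$ (scalar $\epsilon$), with Taylor series in $t$: $W(t)\sim\sum_{|\alpha|>0}t^\alpha X_\alpha$. The $\widehat X_\alpha$ are the unique smooth vector fields with $\gamma_t(x)=e^{\sum_{0<|\alpha|<M}t^\alpha\widehat X_\alpha}x+O(|t|^M)$ for every $M$. $\deg(\alpha)=\sum_i\alpha_ie_i$; $\alpha$ is pure if $\deg\alpha$ has exactly one nonzero component, nonpure otherwise. $\mathcal P=\{(X_\alpha,\deg\alpha):\alpha$ pure$\}$, $\mathcal N=\{(X_\alpha,\deg\alpha):\alpha$ nonpure$\}$, $\widehat{\mathcal P},\widehat{\mathcal N}$ likewise with $\widehat X_\alpha$. $\mathcal L(\mathcal S)$ is the smallest set containing $\mathcal S$ and containing $([Z_1,Z_2],d_1+d_2)$ whenever it contains $(Z_1,d_1),(Z_2,d_2)$. *)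

(* Defs.v *)
From HB Require Import structures.
From mathcomp Require Import all_boot all_order all_algebra.
From mathcomp Require Import all_classical all_reals all_analysis.
Set Implicit Arguments. Unset Strict Implicit. Unset Printing Implicit Defensive.
Import Order.TTheory GRing.Theory Num.Theory.
Import numFieldNormedType.Exports.
Local Open Scope ring_scope.
Local Open Scope classical_set_scope.

Section Defs.
Variable R : realType.

(* vector fields on R^n (only their germ at 0 matters) *)
Definition VF (n : nat) := 'rV[R]_n -> 'rV[R]_n.

Definition coord_vec (m : nat) (i : 'I_m) : 'rV[R]_m := delta_mx 0 i.

Definition iter_partial (m : nat) (V : normedModType R) (s : seq 'I_m)
  (f : 'rV[R]_m -> V) : 'rV[R]_m -> V :=
  foldr (fun i g => fun z => derive g z (coord_vec i)) f s.

Definition smooth_near (m : nat) (V : normedModType R) (f : 'rV[R]_m -> V)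
  (a : 'rV[R]_m) : Prop :=
  exists2 r : R, 0 < r & forall (s : seq 'I_m) (z : 'rV[R]_m), `|z - a| < r ->
    {for z, continuous (iter_partial s f)} /\
    forall i, derivable (iter_partial s f) z (coord_vec i).

Definition unc (N n : nat) (V : Type) (f : 'rV[R]_N -> 'rV[R]_n -> V)
  : 'rV[R]_(N + n) -> V := fun z => f (lsubmx z) (rsubmx z).

Definition mindex (N : nat) := {ffun 'I_N -> nat}.
Definition mi_abs N (a : mindex N) : nat := (\sum_i a i)%N.
Definition mi_fact N (a : mindex N) : nat := (\prod_i (a i)`!)%N.
Definition mi_seq N (a : mindex N) : seq 'I_N :=
  flatten [seq nseq (a i) i | i <- enum 'I_N].
Definition tpow N (t : 'rV[R]_N) (a : mindex N) : R := \prod_i (t 0 i) ^+ a i.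
Definition fmi N M (b : {ffun 'I_N -> 'I_M}) : mindex N :=
  [ffun i => nat_of_ord (b i)].

Definition deg N nu (e : 'I_N -> 'rV[R]_nu) (a : mindex N) : 'rV[R]_nu :=
  \sum_i (a i)%:R *: e i.
Definition pure N nu (e : 'I_N -> 'rV[R]_nu) (a : mindex N) : bool :=
  #|[set mu : 'I_nu | deg e a 0 mu != 0]| == 1%N.

Definition lie n (Z1 Z2 : VF n) : VF n :=
  fun x => derive Z2 x (Z1 x) - derive Z1 x (Z2 x).

Inductive Lgen n nu (S : VF n -> 'rV[R]_nu -> Prop) : VF n -> 'rV[R]_nu -> Prop :=
  | Lgen_base Z d : S Z d -> Lgen S Z d
  | Lgen_br Z1 d1 Z2 d2 : Lgen S Z1 d1 -> Lgen S Z2 d2 ->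
      Lgen S (lie Z1 Z2) (d1 + d2).

Definition Pset N n nu (e : 'I_N -> 'rV[R]_nu) (X : mindex N -> VF n)
  : VF n -> 'rV[R]_nu -> Prop :=
  fun Z d => exists a, [/\ (0 < mi_abs a)%N, pure e a, Z = X a & d = deg e a].
Definition Nset N n nu (e : 'I_N -> 'rV[R]_nu) (X : mindex N -> VF n)
  : VF n -> 'rV[R]_nu -> Prop :=
  fun Z d => exists a, [/\ (0 < mi_abs a)%N, ~~ pure e a, Z = X a & d = deg e a].
Definition PNset N n nu (e : 'I_N -> 'rV[R]_nu) (X : mindex N -> VF n)
  : VF n -> 'rV[R]_nu -> Prop :=
  fun Z d => Pset e X Z d \/ Nset e X Z d.

Definition in_span_deg n nu (S : VF n -> 'rV[R]_nu -> Prop) (Z : VF n)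
  (d : 'rV[R]_nu) : Prop :=
  exists (k : nat) (c : 'I_k -> R) (Zs : 'I_k -> VF n),
    (forall j, S (Zs j) d) /\
    \forall x \near (0 : 'rV[R]_n), Z x = \sum_j c j *: Zs j x.

Definition flow1 n (Y : VF n) (x y : 'rV[R]_n) : Prop :=
  exists c : R -> 'rV[R]_n, [/\ c 0 = x, c 1 = y &
    forall s : R, 0 <= s <= 1 -> is_derive s (1 : R) c (Y (c s))].

(* W(t, x) = d/d eps |_{eps=1} gamma_{eps t} (gamma_t^{-1} x), characterized
   (near (0,0)) by W(t, gamma_t(y)) = d/d eps|_{eps=1} gamma_{eps t}(y) *)
Definition is_W N n (gam W : 'rV[R]_N -> 'rV[R]_n -> 'rV[R]_n) : Prop :=
  smooth_near (unc W) 0 /\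
  exists2 r : R, 0 < r & forall t y, `|t| < r -> `|y| < r ->
    W t (gam t y) = derive (fun eps : R => gam (eps *: t) y) 1 1.

Definition taylor_coef N n (W : 'rV[R]_N -> 'rV[R]_n -> 'rV[R]_n)
  (a : mindex N) : VF n :=
  fun x => (mi_fact a)%:R^-1 *: iter_partial (mi_seq a) (fun t => W t x) 0.

Definition is_exp_coefs N n (gam : 'rV[R]_N -> 'rV[R]_n -> 'rV[R]_n)
  (Xh : mindex N -> VF n) : Prop :=
  (forall a, smooth_near (Xh a) 0) /\
  forall M : nat, exists2 delta : R, 0 < delta & exists2 C : R, 0 < C &
    forall (t : 'rV[R]_N) (x : 'rV[R]_n), `|t| < delta -> `|x| < delta ->
      exists y, flow1
        (fun z => \sum_(b : {ffun 'I_N -> 'I_M} | (0 < mi_abs (fmi b) < M)%N)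
                    tpow t (fmi b) *: Xh (fmi b) z) x y
      /\ `|gam t x - y| <= C * `|t| ^+ M.

End Defs.

(* Main.v *)
Require Import Defs.
From HB Require Import structures.
From mathcomp Require Import all_boot all_order all_algebra.
From mathcomp Require Import all_classical all_reals all_analysis.
From mathcomp Require Import ring lra zify.
Set Implicit Arguments. Unset Strict Implicit. Unset Printing Implicit Defensive.
Import Order.TTheory GRing.Theory Num.Theory.
Import numFieldNormedType.Exports.
Local Open Scope ring_scope.
Local Open Scope classical_set_scope.

(** Let [Y_t = sum_a t^a Xh_a] and let [E] be the Euler operator in [t]. Expanding a smooth
    function along the flow of [Y_t] gives [f (gam_t x) ~ (exp Y_t f) x], so that
    [E gam_t x = W_t (gam_t x)] becomes [E (exp Y_t) id = exp Y_t W_t] as an identity of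
    asymptotic series in [t]. In the associative algebra of differential operators
    [E (exp Y) = exp Y * sum_q ad^q (E Y) / (q + 1)!] with [ad B = [B, Y]], and [exp Y] is
    injective on series, whence [W_t ~ sum_q ad^q (E Y_t) / (q + 1)!]. Comparing the
    coefficients of [t^a], [X_a] equals [|a| Xh_a] plus iterated brackets of [Xh_b]'s whose
    indices are nonzero and add up to [a]; by induction on [|a|] this is also solved for
    [Xh_a]. If [a] is pure, so are all the indices [b] involved, because the [e_i] are
    nonnegative and nonzero. *)

(** * Smooth functions on open sets *)

(** Series are handled through truncations at an arbitrary order M, as finite sums of monomials in t
    with smooth coefficients, so that an asymptotic identity becomes a statement on the low-order
    terms of a polynomial. The obstacle is that E cannot be applied to an expansion with error
    O(|t|^M), since nothing controls the derivative of the error. The way around is to restrict to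
    rays e t and to expand separately gam_{et}(x) and its Euler derivative, which is
    W_{et}(gam_{et}(x)): when both have polynomial expansions, the mean value theorem forces the
    second to be the Euler derivative of the first up to order M ([euler_poly]). Information along
    rays is then promoted to order in t degree by degree, because Y_t raises the order by at least
    one. The factor 1/(q+1)! comes from [E, Y^k] = sum_q C(k, q+1) Y^(k-q-1) ad^q(E Y) after
    division by k!. Brackets are labelled by multi-indices and not by degrees: several indices may
    share a degree, and the induction runs on |a|. *)

Section Calculus.
Variable R : realType.

Lemma norm_coord_le m (v : 'rV[R]_m) i : `|v 0 i| <= `|v|.
Proof.
rewrite [leRHS]/Num.Def.normr/= mx_normrE.
exact: (le_bigmax _ (fun ij : 'I_1 * 'I_m => `|v ij.1 ij.2|) (0, i)).
Qed.

Lemma norm_le_coord m (v : 'rV[R]_m) c : 0 <= c ->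
  (forall i, `|v 0 i| <= c) -> `|v| <= c.
Proof.
move=> c0 H; rewrite [leLHS]/Num.Def.normr/= mx_normrE bigmax_le// => -[i j] _.
by rewrite ord1; exact: H.
Qed.

Lemma norm_lt_coord m (v : 'rV[R]_m) c : 0 < c ->
  (forall i, `|v 0 i| < c) -> `|v| < c.
Proof.
move=> c0 H; rewrite [ltLHS]/Num.Def.normr/= mx_normrE.
by apply/bigmax_ltP; split => // -[i j] _; rewrite ord1; exact: H.
Qed.

Definition partial m (i : 'I_m) (f : 'rV[R]_m -> R) : 'rV[R]_m -> R :=
  fun z => 'D_(coord_vec R i) f z.

Lemma norm_scale_coord_vec m (i : 'I_m) (h : R) : `|h *: coord_vec R i| <= `|h|.
Proof.
apply: norm_le_coord => // j; rewrite !mxE/=; case: (_ == _) => /=.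
  by rewrite mulr1.
by rewrite mulr0 normr0.
Qed.

Lemma is_derive_line (V W : normedModType R) (f : V -> W) (z v : V) (s : R) :
  derivable f (s *: v + z) v ->
  is_derive s (1 : R) (fun s : R => f (s *: v + z)) ('D_v f (s *: v + z)).
Proof.
move=> df.
have E : (fun h : R => h^-1 *: (f ((h *: (1 : R) + s) *: v + z) - f (s *: v + z))) =
  (fun h : R => h^-1 *: (f (h *: v + (s *: v + z)) - f (s *: v + z))).
  by apply/funext => h; rewrite scalerDl -addrA [_ *: 1]mulr1.
apply: DeriveDef; first by rewrite /derivable E.
by rewrite /derive E.
Qed.

Lemma MVT_derivable (f df : R -> R) (a b : R) : a <= b ->
  (forall s, a <= s <= b -> is_derive s (1 : R) f (df s)) ->
  exists2 c, a <= c <= b & f b - f a = df c * (b - a).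
Proof.
move=> ab H.
have [||c] := @MVT_segment R f df a b ab.
- move=> x; rewrite in_itv/= => /andP[/ltW ax /ltW xb]; apply: H.
  by rewrite ax xb.
- apply: derivable_within_continuous => x; rewrite in_itv/= => xab.
  by have [] := H _ xab.
- by rewrite in_itv/= => cab E; exists c.
Qed.

Lemma mean_value_coord m (f : 'rV[R]_m -> R) (z : 'rV[R]_m) (i : 'I_m) (h : R) :
  (forall s : R, `|s| <= `|h| -> derivable f (s *: coord_vec R i + z) (coord_vec R i)) ->
  exists2 s : R, `|s| <= `|h| &
    f (h *: coord_vec R i + z) - f z = h * partial i f (s *: coord_vec R i + z).
Proof.
move=> H; set v := coord_vec R i in H *.
have D s : `|s| <= `|h| ->
    is_derive s (1 : R) (fun s : R => f (s *: v + z)) ('D_v f (s *: v + z)).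
  by move=> sh; apply: is_derive_line; exact: H.
have [h0|h0] := leP 0 h.
  have [|c /andP[c0 ch]] := MVT_derivable h0 (df := fun s => 'D_v f (s *: v + z))
    (f := fun s : R => f (s *: v + z)).
    by move=> s /andP[s0 sh]; apply: D; rewrite !ger0_norm.
  rewrite scale0r add0r subr0 mulrC => E; exists c; last exact: E.
  by rewrite !ger0_norm.
have [|c /andP[ch c0]] := MVT_derivable (ltW h0) (df := fun s => 'D_v f (s *: v + z))
    (f := fun s : R => f (s *: v + z)).
  by move=> s /andP[s0 sh]; apply: D; rewrite (ltr0_norm h0) ler0_norm // lerN2.
rewrite scale0r add0r sub0r => E; exists c.
  by rewrite (ltr0_norm h0) ler0_norm // lerN2.
by rewrite -opprB E mulrN opprK mulrC.
Qed.

(** Going from z to z + h along a staircase that changes one coordinate at a time uses only partial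
    derivatives, at the price of one intermediate point per coordinate. In the sup norm no corner is
    further from z than z + h. *)
Lemma mean_value m (f : 'rV[R]_m -> R) (z h : 'rV[R]_m) :
  (forall w i, `|w - z| <= `|h| -> derivable f w (coord_vec R i)) ->
  exists2 w : 'I_m -> 'rV[R]_m, (forall k, `|w k - z| <= `|h|) &
    f (h + z) - f z = \sum_k h 0 k * partial k f (w k).
Proof.
move=> H.
(* [tr k] keeps the first k coordinates of h: these are the corners of the staircase. *)
pose tr (k : nat) : 'rV[R]_m := \row_j (if (j < k)%N then h 0 j else 0).
have trS (k : 'I_m) : tr k.+1 = h 0 k *: coord_vec R k + tr k.
  apply/rowP => j; rewrite !mxE/= ltnS leq_eqVlt -(inj_eq val_inj).
  by case: (ltngtP j k) => /= jk; rewrite ?mulr0 ?add0r ?mulr1 ?addr0 // (val_inj jk).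
have tr0 : tr 0%N = 0 by apply/rowP => j; rewrite !mxE.
have trm : tr m = h by apply/rowP => j; rewrite !mxE ltn_ord.
have X (k : 'I_m) : exists w : 'rV[R]_m, `|w - z| <= `|h| /\
    f (tr k.+1 + z) - f (tr k + z) = h 0 k * partial k f w.
  have B (s : R) : `|s| <= `|h 0 k| -> `|s *: coord_vec R k + tr k| <= `|h|.
    move=> sh; apply: norm_le_coord => // j; rewrite !mxE/=.
    case: eqP => [->|_]; last first.
      rewrite mulr0 add0r; case: ifP => _; first exact: norm_coord_le.
      by rewrite normr0.
    by rewrite ltnn mulr1 addr0 (le_trans sh) // norm_coord_le.
  have [|s sh E] := @mean_value_coord m f (tr k + z) k (h 0 k).
    by move=> s sh; apply: H; rewrite addrA addrK; exact: B.
  exists (s *: coord_vec R k + (tr k + z)); split.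
    by rewrite addrA addrK; exact: B.
  by rewrite trS -addrA.
have [w Hw] := choice X.
exists w; first by move=> k; have [] := Hw k.
transitivity (\sum_(0 <= k < m) (f (tr k.+1 + z) - f (tr k + z))).
  by rewrite telescope_sumr // trm tr0 add0r.
by rewrite big_mkord; apply: eq_bigr => k _; have [_] := Hw k.
Qed.

Definition smooth_on m (U : set 'rV[R]_m) (f : 'rV[R]_m -> R) : Prop :=
  forall s z, U z -> {for z, continuous (iter_partial s f)} /\
    forall i, derivable (iter_partial s f) z (coord_vec R i).

Lemma iter_partial_cat m (V : normedModType R) (s1 s2 : seq 'I_m) (f : 'rV[R]_m -> V) :
  iter_partial (s1 ++ s2) f = iter_partial s1 (iter_partial s2 f).
Proof. by rewrite /iter_partial foldr_cat. Qed.

Section Smooth.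
Variables (m : nat) (U : set 'rV[R]_m).
Hypothesis Uo : open U.

Lemma smooth_on_iter f s : smooth_on U f -> smooth_on U (iter_partial s f).
Proof. by move=> H s' z Uz; rewrite -iter_partial_cat; exact: H. Qed.

Lemma smooth_on_partial f i : smooth_on U f -> smooth_on U (partial i f).
Proof. by move=> H; exact: (@smooth_on_iter f [:: i]). Qed.

Lemma smooth_on_content f z : smooth_on U f -> U z -> {for z, continuous f}.
Proof. by move=> H Uz; have [] := H [::] z Uz. Qed.

Lemma smooth_on_derivable f z i : smooth_on U f -> U z -> derivable f z (coord_vec R i).
Proof. by move=> H Uz; have [_] := H [::] z Uz. Qed.

Lemma open_near z : U z -> \forall w \near z, U w.
Proof. by move=> Uz; exact: open_nbhs_nbhs. Qed.

Lemma near_on (P : 'rV[R]_m -> Prop) z :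
  (forall x, U x -> P x) -> U z -> \forall w \near z, P w.
Proof. by move=> H /open_near; apply: filterS. Qed.

Lemma cont_eq (V : topologicalType) (f g : 'rV[R]_m -> V) z :
  (forall x, U x -> f x = g x) -> U z ->
  {for z, continuous f} -> {for z, continuous g}.
Proof.
move=> fg Uz fc; change (g @ z --> g z).
rewrite -(fg _ Uz); apply: cvg_trans fc.
apply: (@near_eq_cvg _ _ (nbhs z)); apply: near_on Uz => x Ux.
by rewrite fg.
Qed.

Lemma partial_eq f g i z : (forall x, U x -> f x = g x) -> U z -> partial i f z = partial i g z.
Proof. by move=> fg Uz; apply: near_eq_derive; exact: near_on. Qed.

(** A coinduction principle: a class of functions with one order of regularity, stable under partial
    derivatives up to equality on U, contains only smooth functions. Closure properties then need no
    formula for higher derivatives. *)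
Lemma smooth_on_coind (C : set ('rV[R]_m -> R)) :
  (forall f, C f -> forall z, U z -> {for z, continuous f} /\
     forall i, derivable f z (coord_vec R i)) ->
  (forall f i, C f -> exists2 g, C g & forall x, U x -> partial i f x = g x) ->
  forall f, C f -> smooth_on U f.
Proof.
move=> C1 C2 f Cf s.
have [g Cg fg] : exists2 g, C g & forall x, U x -> iter_partial s f x = g x.
  elim: s => [|i s [g Cg fg]]; first by exists f.
  have [g' Cg' gg'] := C2 g i Cg; exists g' => // x Ux.
  by rewrite -gg' //; apply: partial_eq.
move=> z Uz; have [gc gd] := C1 g Cg z Uz.
split; first by apply: cont_eq gc => // x Ux; rewrite fg.
by move=> i; apply: near_eq_derivable (gd i); apply: near_on Uz => x Ux; rewrite fg.
Qed.

(** Products alone are not stable under differentiation, since the Leibniz rule produces sums of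
    products; the generated algebra is, so [smooth_on_coind] applies to it. *)
Inductive smooth_alg : ('rV[R]_m -> R) -> Prop :=
| smooth_alg_base f : smooth_on U f -> smooth_alg f
| smooth_alg_add f g : smooth_alg f -> smooth_alg g -> smooth_alg (f + g)
| smooth_alg_mul f g : smooth_alg f -> smooth_alg g -> smooth_alg (f * g).

Lemma smooth_alg_reg f : smooth_alg f -> forall z, U z -> {for z, continuous f} /\
     forall i, derivable f z (coord_vec R i).
Proof.
elim=> {f} [f Sf z Uz|f g _ IHf _ IHg z Uz|f g _ IHf _ IHg z Uz].
- exact: (Sf [::]).
- have [c1 d1] := IHf z Uz; have [c2 d2] := IHg z Uz; split.
    exact: continuousD.
  by move=> i; apply: derivableD.
- have [c1 d1] := IHf z Uz; have [c2 d2] := IHg z Uz; split.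
    exact: continuousM.
  by move=> i; apply: derivableM.
Qed.

Lemma smooth_alg_smooth f : smooth_alg f -> smooth_on U f.
Proof.
apply: (smooth_on_coind smooth_alg_reg) => {}f i.
elim=> {f} [f Sf|f g Af [f' Af' ff'] Ag [g' Ag' gg']|f g Af [f' Af' ff'] Ag [g' Ag' gg']].
- by exists (partial i f) => //; apply/smooth_alg_base/smooth_on_partial.
- exists (f' + g'); first exact: smooth_alg_add.
  move=> x Ux; rewrite /partial deriveD; last 2 first.
  + by have [_] := smooth_alg_reg Af Ux.
  + by have [_] := smooth_alg_reg Ag Ux.
  by rewrite -/(partial i f x) -/(partial i g x) ff' // gg'.
- exists (f * g' + g * f').
    by apply: smooth_alg_add; apply: smooth_alg_mul.
  move=> x Ux; rewrite /partial deriveM; last 2 first.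
  + by have [_] := smooth_alg_reg Af Ux.
  + by have [_] := smooth_alg_reg Ag Ux.
  by rewrite -/(partial i f x) -/(partial i g x) ff' // gg'.
Qed.

Lemma smooth_on_eq f g : (forall x, U x -> f x = g x) -> smooth_on U f -> smooth_on U g.
Proof.
move=> fg Sf; apply: (@smooth_on_coind (fun g => exists2 f, smooth_on U f & forall x, U x -> f x = g x));
  last by exists f.
- move=> {fg Sf}{}g [{}f Sf fg] z Uz.
  split; first by apply: cont_eq (smooth_on_content Sf Uz).
  by move=> i; apply: (@near_eq_derivable _ _ _ f); [exact: near_on|exact: smooth_on_derivable].
- move=> {fg Sf}{}g i [{}f Sf fg]; exists (partial i f).
    by exists (partial i f) => //; exact: smooth_on_partial.
  by move=> x Ux; apply/esym/partial_eq.
Qed.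

Lemma smooth_on_add f g : smooth_on U f -> smooth_on U g -> smooth_on U (fun x => f x + g x).
Proof. by move=> Sf Sg; apply: smooth_alg_smooth; apply: smooth_alg_add; apply: smooth_alg_base. Qed.

Lemma smooth_on_mul f g : smooth_on U f -> smooth_on U g -> smooth_on U (fun x => f x * g x).
Proof. by move=> Sf Sg; apply: smooth_alg_smooth; apply: smooth_alg_mul; apply: smooth_alg_base. Qed.

Lemma smooth_on_cst c : smooth_on U (fun=> c).
Proof.
apply: (@smooth_on_coind (fun f => exists c, f = fun=> c)); last by exists c.
- by move=> f [{}c ->] z Uz; split; [exact: cst_continuous|move=> i; exact: derivable_cst].
- move=> f i [{}c ->]; exists (fun=> 0); first by exists 0.
  by move=> x Ux; exact: derive_cst.
Qed.

Lemma smooth_on_scale c f : smooth_on U f -> smooth_on U (fun x => c * f x).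
Proof. by move=> Sf; apply: smooth_on_mul => //; exact: smooth_on_cst. Qed.

Lemma smooth_on_sub f g : smooth_on U f -> smooth_on U g -> smooth_on U (fun x => f x - g x).
Proof.
move=> Sf Sg; apply: smooth_on_add => //.
by have := smooth_on_scale (-1) Sg; apply: smooth_on_eq => x _; rewrite mulN1r.
Qed.

Lemma smooth_on_sum (I : finType) (f : I -> 'rV[R]_m -> R) :
  (forall i, smooth_on U (f i)) -> smooth_on U (fun x => \sum_i f i x).
Proof.
move=> Sf; rewrite /index_enum; elim: (Finite.enum _) => [|i s IH].
  by apply: smooth_on_eq (smooth_on_cst 0) => x _; rewrite big_nil.
by apply: smooth_on_eq (smooth_on_add (Sf i) IH) => x _; rewrite big_cons.
Qed.

Lemma partial_add f g i z : smooth_on U f -> smooth_on U g -> U z ->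
  partial i (fun x => f x + g x) z = partial i f z + partial i g z.
Proof. by move=> Sf Sg Uz; apply: deriveD; exact: smooth_on_derivable. Qed.

Lemma partial_mul f g i z : smooth_on U f -> smooth_on U g -> U z ->
  partial i (fun x => f x * g x) z = f z * partial i g z + g z * partial i f z.
Proof. by move=> Sf Sg Uz; apply: deriveM; exact: smooth_on_derivable. Qed.

Lemma partial_cst c (i : 'I_m) z : partial i (fun=> c) z = 0.
Proof. exact: derive_cst. Qed.

Lemma partial_scale c f i z : smooth_on U f -> U z -> partial i (fun x => c * f x) z = c * partial i f z.
Proof.
by move=> Sf Uz; rewrite partial_mul //; [rewrite partial_cst mulr0 addr0|exact: smooth_on_cst].
Qed.

Lemma partial_sum (I : finType) (f : I -> 'rV[R]_m -> R) i z :
  (forall j, smooth_on U (f j)) -> U z ->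
  partial i (fun x => \sum_j f j x) z = \sum_j partial i (f j) z.
Proof.
move=> Sf Uz; rewrite /index_enum; elim: (Finite.enum _) => [|j s IH].
  by rewrite big_nil -[RHS](partial_cst 0 i z); apply: partial_eq => // x _; rewrite big_nil.
rewrite big_cons -IH -partial_add //; first by apply: partial_eq => // x _; rewrite big_cons.
elim: s {IH} => [|k s IH]; first by apply: smooth_on_eq (smooth_on_cst 0) => x _; rewrite big_nil.
by apply: smooth_on_eq (smooth_on_add (Sf k) IH) => x _; rewrite big_cons.
Qed.

Lemma open_dist z : U z -> exists2 r : R, 0 < r & forall w, `|w - z| < r -> U w.
Proof.
move=> Uz; have /nbhs_ballP [r r0 H] : nbhs z U by exact: open_near.
by exists r => // w wz; apply: H; rewrite -ball_normE /ball_/= distrC.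
Qed.

Lemma cont_dist (f : 'rV[R]_m -> R) z (e : R) : 0 < e -> {for z, continuous f} ->
  exists2 r : R, 0 < r & forall w, `|w - z| < r -> `|f w - f z| < e.
Proof.
move=> e0 /cvgrPdist_lt/(_ _ e0)/nbhs_ballP[r r0 H].
exists r => // w wz; rewrite distrC; apply: H.
by rewrite -ball_normE /ball_/= distrC.
Qed.

Lemma mean_value_smooth f z r h : smooth_on U f -> (forall w, `|w - z| < r -> U w) -> `|h| < r ->
  exists2 w : 'I_m -> 'rV[R]_m, (forall k, `|w k - z| <= `|h|) &
    f (h + z) - f z = \sum_k h 0 k * partial k f (w k).
Proof.
move=> Sf Ur hr; apply: mean_value => w i wz; apply: smooth_on_derivable => //.
by apply: Ur; exact: le_lt_trans hr.
Qed.

Lemma smooth_on_bounded f z : smooth_on U f -> U z -> exists2 r : R, 0 < r &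
  exists2 C : R, 0 < C & forall w, `|w - z| < r -> `|f w| <= C.
Proof.
move=> Sf Uz; have [r r0 H] := cont_dist ltr01 (smooth_on_content Sf Uz).
exists r => //; exists (`|f z| + 1); first by rewrite ltr_wpDl.
move=> w /H wz; rewrite -[f w](subrK (f z)) addrC.
by apply: (le_trans (ler_normD _ _)); rewrite lerD2l ltW.
Qed.
End Smooth.
End Calculus.

(** * Differentiability, symmetry of second derivatives, local Lipschitz bounds *)

Section Calculus2.
Variable R : realType.

Lemma sub4_comm (a b c d : R) : a - b - (c - d) = a - c - (b - d).
Proof. ring. Qed.

Lemma dist_le_halves (a b c e : R) :
  `|c - a| < e / 2 -> `|c - b| < e / 2 -> `|a - b| <= e.
Proof. by rewrite !ltr_distl ler_distl => /andP[? ?] /andP[? ?]; apply/andP; split; lra. Qed.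

Section OneSet.
Variables (m : nat) (U : set 'rV[R]_m).
Hypothesis Uo : open U.

(** Continuity of the partial derivatives gives differentiability: [mean_value] writes the increment
    with partials at nearby points, which differ little from those at z. *)
Lemma smooth_on_diff (f : 'rV[R]_m -> R) z : smooth_on U f -> U z ->
  differentiable f z /\ forall v, 'd f z v = \sum_i v 0 i * partial i f z.
Proof.
move=> Sf Uz.
pose df (v : 'rV[R]_m) : R := \sum_i v 0 i * partial i f z.
have dfl : linear df.
  move=> a u v; rewrite /df scaler_sumr -big_split/=; apply: eq_bigr => i _.
  by rewrite !mxE mulrDl -mulrA.
pose dfM := GRing.isLinear.Build _ _ _ _ df dfl.
pose dfL : {linear 'rV[R]_m -> R} := HB.pack df dfM.
have dfc : continuous dfL.
  move=> v.
  have -> : (dfL : _ -> R) = (fun v => df v) by [].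
  apply: differentiable_continuous.
  have -> : (fun v => df v) = \sum_(i < m) (fun v : 'rV[R]_m => v 0 i * partial i f z).
    by apply/funext => w; rewrite fct_sumE.
  apply: differentiable_sum => i.
  apply: differentiableM => //; exact: differentiable_coord.
have uniq_d := @diff_unique R _ _ f dfL z dfc.
match type of uniq_d with ?A -> _ => have E : A end.
  apply/eqaddoP => e e0.
  have [r r0 Ur] := open_dist Uo Uz.
  (* The error is shared among m coordinates; m + 1 avoids a division by zero when m = 0. *)
  have e1 : 0 < e / (m%:R + 1) by rewrite divr_gt0 // ltr_wpDl.
  have [rr rr0 Hr] : exists2 rr : R, 0 < rr & forall i w, `|w - z| < rr ->
      `|partial i f w - partial i f z| < e / (m%:R + 1).
    have : \forall w \near z, forall i, `|partial i f w - partial i f z| < e / (m%:R + 1).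
      apply: (@filter_forall _ _ (fun i w => `|partial i f w - partial i f z| < e / (m%:R + 1)) (nbhs z) _) => i.
      have /cvgrPdist_lt/(_ _ e1) := smooth_on_content (smooth_on_partial i Sf) Uz.
      by apply: filterS => w; rewrite distrC.
    move=> /nbhs_ballP[rr rr0 H]; exists rr => // i w wz; apply: H.
    by rewrite -ball_normE /ball_/= distrC.
  have r2 : 0 < Num.min r rr by rewrite lt_min r0.
  have := @nbhs0_lt _ 'rV[R]_m _ r2; apply: filterS => h.
  rewrite lt_min => /andP[hr hrr].
  have [w wz E] := mean_value_smooth Sf Ur hr.
  set lhs := (X in `|X| <= _).
  have -> : lhs = \sum_k h 0 k * (partial k f (w k) - partial k f z).
    rewrite -[LHS]/(f (h + z) - (f z + df h)) opprD addrA E /df -sumrB.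
    by apply: eq_bigr => k _; rewrite mulrBr.
  apply: (le_trans (ler_norm_sum _ _ _)).
  apply: (@le_trans _ _ (\sum_(k < m) (e / (m%:R + 1) * `|h|))).
    apply: ler_sum => k _; rewrite normrM mulrC ler_pM //; last exact: norm_coord_le.
    by apply: ltW; apply: Hr; apply: le_lt_trans (wz k) hrr.
  rewrite sumr_const card_ord -[leLHS]mulr_natl mulrA ler_wpM2r //.
  rewrite mulrCA -[leRHS]mulr1 ler_wpM2l ?(ltW e0) //.
  by rewrite ler_pdivrMr ?mul1r ?lerDl // ltr_wpDl.
have D : 'd f z = dfL :> (_ -> _) by exact: uniq_d.
split; last by move=> v; rewrite D.
by apply/diff_locallyP; rewrite D.
Qed.

Lemma smooth_on_derive (f : 'rV[R]_m -> R) z v : smooth_on U f -> U z ->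
  derivable f z v /\ 'D_v f z = \sum_i v 0 i * partial i f z.
Proof.
move=> Sf Uz; have [d E] := smooth_on_diff Sf Uz.
by split; [exact: diff_derivable|rewrite deriveE].
Qed.

Lemma smooth_on_chain (f : 'rV[R]_m -> R) (c : R -> 'rV[R]_m) (s : R) v : smooth_on U f -> U (c s) ->
  is_derive s (1 : R) c v ->
  is_derive s (1 : R) (fun s => f (c s)) (\sum_i v 0 i * partial i f (c s)).
Proof.
move=> Sf Uc [dc cv]; have [d E] := smooth_on_diff Sf Uc.
have dc' : differentiable c s by apply/derivable1_diffP.
apply: DeriveDef.
  by apply/derivable1_diffP; exact: (differentiable_comp dc' d).
rewrite deriveE; last exact: (differentiable_comp dc' d).
by rewrite (diff_comp dc' d) /= -[X in 'd _ _ X]deriveE // cv E.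
Qed.

Lemma partial_coord (i j : 'I_m) (z : 'rV[R]_m) :
  partial j (fun x : 'rV[R]_m => x 0 i) z = (i == j)%:R.
Proof.
have @f : {linear 'rV[R]_m -> R}.
  by exists (fun N : 'rV[R]_m => N 0 i); do 2![eexists]; do ?[constructor];
    rewrite ?mxE// => ? *; rewrite ?mxE//; move=> ?; rewrite !mxE.
have d := @differentiable_coord R 1 m z 0 i.
rewrite /partial deriveE //.
have -> : (fun x : 'rV[R]_m => x 0 i) = f by [].
rewrite diff_lin; last exact: coord_continuous.
by rewrite /f/= /coord_vec mxE eqxx.
Qed.

Lemma smooth_on_coord (i : 'I_m) : smooth_on U (fun x : 'rV[R]_m => x 0 i).
Proof.
apply: (@smooth_on_coind R m U Uo (fun f => f = (fun x => x 0 i) \/ exists c, f = fun=> c)); last by left.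
- move=> f [->|[c ->]] z Uz; split.
  + exact: coord_continuous.
  + by move=> j; apply: diff_derivable; exact: differentiable_coord.
  + exact: cst_continuous.
  + by move=> j; exact: derivable_cst.
- move=> f j [->|[c ->]].
  + exists (fun=> (i == j)%:R); first by right; exists (i == j)%:R.
    by move=> x _; exact: partial_coord.
  + exists (fun=> 0); first by right; exists 0.
    by move=> x _; exact: derive_cst.
Qed.

Lemma partial_shift (f : 'rV[R]_m -> R) i a z : partial i (fun w => f (a + w)) z = partial i f (a + z).
Proof.
rewrite /partial /derive; congr (lim _).
have -> : (fun h : R => h^-1 *: (f (a + (h *: coord_vec R i + z)) - f (a + z))) =
  (fun h : R => h^-1 *: (f (h *: coord_vec R i + (a + z)) - f (a + z))) => //.
by apply/funext => h /=; rewrite addrCA.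
Qed.

Lemma derivable_shift (f : 'rV[R]_m -> R) a z v :
  derivable f (a + z) v -> derivable (fun w => f (a + w)) z v.
Proof.
rewrite /derivable.
have -> : (fun h : R => h^-1 *: (f (a + (h *: v + z)) - f (a + z))) =
  (fun h : R => h^-1 *: (f (h *: v + (a + z)) - f (a + z))) => //.
by apply/funext => h /=; rewrite addrCA.
Qed.

(** The mean value theorem is applied in direction i to a difference in direction j, then in
    direction j. The resulting second difference is symmetric in i and j, whereas the mixed
    derivative on the left is not visibly so. *)
Lemma second_difference (f : 'rV[R]_m -> R) z r i j h : smooth_on U f ->
  (forall w, `|w - z| < r -> U w) -> 2 * `|h| < r -> h != 0 ->
  exists2 w, `|w - z| <= 2 * `|h| &
  h ^+ 2 * partial j (partial i f) w =
   f (h *: coord_vec R i + (h *: coord_vec R j + z)) - f (h *: coord_vec R j + z)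
   - (f (h *: coord_vec R i + z) - f z).
Proof.
move=> Sf Ur hr h0.
set ei := coord_vec R i; set ej := coord_vec R j.
have dS k w : U w -> derivable f w (coord_vec R k) by exact: smooth_on_derivable.
have near2 (s t : R) : `|s| <= `|h| -> `|t| <= `|h| ->
    `|s *: ej + (t *: ei + z) - z| <= 2 * `|h|.
  move=> sh th; rewrite addrA addrK mulr_natl mulr2n.
  by apply: (le_trans (ler_normD _ _)); apply: lerD;
    apply: le_trans (norm_scale_coord_vec _ _) _.
pose g w := f (h *: ej + w) - f w.
have dg (s : R) : `|s| <= `|h| ->
   derivable (fun w => f (h *: ej + w)) (s *: ei + z) ei /\ derivable f (s *: ei + z) ei.
  move=> sh; split.
    apply: derivable_shift; apply: dS.
    by apply: Ur; apply: le_lt_trans hr; exact: near2.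
  apply: dS; apply: Ur; apply: le_lt_trans hr.
  by have := near2 0 s; rewrite scale0r add0r normr0; apply.
have [|s sh E] := @mean_value_coord R m g z i h.
  move=> s sh; have [d1 d2] := dg s sh.
  have -> : g = (fun w => f (h *: ej + w)) - f by [].
  exact: derivableB.
have [|t th E2] := @mean_value_coord R m (partial i f) (s *: ei + z) j h.
  move=> t th; apply: (@smooth_on_derivable R m U); first exact: smooth_on_partial.
  by apply: Ur; apply: le_lt_trans hr; exact: near2.
exists (t *: ej + (s *: ei + z)); first exact: near2.
have -> : f (h *: ei + (h *: ej + z)) - f (h *: ej + z) - (f (h *: ei + z) - f z) =
  g (h *: ei + z) - g z by rewrite /g [h *: ei + (h *: ej + z)]addrCA; exact: sub4_comm.
have [d1 d2] := dg s sh.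
have Eg : partial i g (s *: ei + z) = partial i f (h *: ej + (s *: ei + z)) - partial i f (s *: ei + z).
  transitivity (partial i (fun w => f (h *: ej + w)) (s *: ei + z) - partial i f (s *: ei + z)).
    have -> : g = (fun w => f (h *: ej + w)) - f by [].
    by rewrite /partial deriveB.
  by rewrite partial_shift.
by rewrite E Eg E2 expr2 mulrA.
Qed.

(** Both mixed derivatives, taken at points close to z, equal the same second difference divided by
    h^2; continuity brings these points to z. *)
Lemma partial_comm (f : 'rV[R]_m -> R) z i j : smooth_on U f -> U z ->
  partial i (partial j f) z = partial j (partial i f) z.
Proof.
move=> Sf Uz; apply/eqP; rewrite -subr_eq0 -normr_le0.
apply/ler_addgt0Pl => e e0; rewrite addr0.
have e2 : 0 < e / 2 by rewrite divr_gt0.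
have [r r0 Ur] := open_dist Uo Uz.
have [r1 r10 H1] := cont_dist e2 (smooth_on_content (smooth_on_partial i (smooth_on_partial j Sf)) Uz).
have [r2 r20 H2] := cont_dist e2 (smooth_on_content (smooth_on_partial j (smooth_on_partial i Sf)) Uz).
(* [second_difference] reaches up to 2 |h| from z, so a quarter of the smallest radius keeps
   strictly inside. *)
pose h := Num.min r (Num.min r1 r2) / 4.
have mn0 : 0 < Num.min r (Num.min r1 r2) by rewrite !lt_min r0 r10 r20.
have h0 : 0 < h by rewrite divr_gt0.
have h2 : 2 * `|h| < Num.min r (Num.min r1 r2).
  by rewrite gtr0_norm // /h; lra.
move: (h2); rewrite !lt_min => /and3P[hr hr1 hr2].
have [w1 w1z E1] := second_difference i j Sf Ur hr (lt0r_neq0 h0).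
have [w2 w2z E2] := second_difference j i Sf Ur hr (lt0r_neq0 h0).
have E : partial j (partial i f) w1 = partial i (partial j f) w2.
  have h20 : h ^+ 2 != 0 by rewrite expf_neq0 // lt0r_neq0.
  suff : h ^+ 2 * partial j (partial i f) w1 = h ^+ 2 * partial i (partial j f) w2 by move/(mulfI h20).
  refine (etrans E1 (etrans _ (esym E2))).
  rewrite (addrCA (h *: coord_vec R i)); exact: sub4_comm.
have := H1 w2 (le_lt_trans w2z hr1); have := H2 w1 (le_lt_trans w1z hr2).
by rewrite E => b a; exact: dist_le_halves a b.
Qed.

(** Identifies the terms of a Taylor expansion written with words in the coordinates when the words
    have the same letters. *)
Lemma iter_partial_perm (f : 'rV[R]_m -> R) (s1 s2 : seq 'I_m) z : smooth_on U f -> U z ->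
  perm_eq s1 s2 -> iter_partial s1 f z = iter_partial s2 f z.
Proof.
move=> Sf.
elim: s1 s2 z => [|i s1 IH] s2 z Uz; first by rewrite perm_sym => /perm_nilP ->.
move=> p; have i2 : i \in s2 by rewrite -(perm_mem p) mem_head.
case/path.splitPr: i2 p => a b p.
have p' : perm_eq s1 (a ++ b).
  by rewrite -(perm_cons i) (perm_trans p) // perm_catC /= perm_cons perm_catC.
transitivity (iter_partial (i :: (a ++ b)) f z).
  by apply: (partial_eq Uo i) => // x Ux; exact: IH.
transitivity (iter_partial (i :: a) (iter_partial b f) z).
  by rewrite -iter_partial_cat.
rewrite -cat_rcons iter_partial_cat.
have Sb := smooth_on_iter b Sf.
elim: a z Uz {p p'} => [|j a IHa] z Uz //=.
transitivity (partial j (partial i (iter_partial a (iter_partial b f))) z).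
  by apply: partial_comm => //; exact: smooth_on_iter.
by apply: (partial_eq Uo) => // x Ux; exact: IHa.
Qed.

Lemma smooth_on_Lipschitz (f : 'rV[R]_m -> R) z : smooth_on U f -> U z -> exists2 r : R, 0 < r &
  exists2 C : R, 0 < C & forall w1 w2, `|w1 - z| < r -> `|w2 - z| < r ->
    `|f w1 - f w2| <= C * `|w1 - w2|.
Proof.
move=> Sf Uz.
have [r r0 Ur] := open_dist Uo Uz.
have [r1 r10 Hr] : exists2 rr : R, 0 < rr & forall i w, `|w - z| < rr ->
      `|partial i f w - partial i f z| < 1.
  have : \forall w \near z, forall i, `|partial i f w - partial i f z| < 1.
    apply: (@filter_forall _ _ (fun i w => `|partial i f w - partial i f z| < 1) (nbhs z) _) => i.
    have /cvgrPdist_lt/(_ _ ltr01) := smooth_on_content (smooth_on_partial i Sf) Uz.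
    by apply: filterS => w; rewrite distrC.
  move=> /nbhs_ballP[rr rr0 H]; exists rr => // i w wz; apply: H.
  by rewrite -ball_normE /ball_/= distrC.
pose r2 := Num.min r r1; have r20 : 0 < r2 by rewrite lt_min r0.
(* Two points within r2 / 3 of z are less than 2 r2 / 3 apart, so the intermediate points of the
   mean value theorem, centred at one of them, stay within r2 of z. *)
exists (r2 / 3); first by rewrite divr_gt0.
exists (\sum_i (`|partial i f z| + 1) + 1).
  by rewrite ltr_wpDl // sumr_ge0 // => i _; rewrite addr_ge0.
move=> w1 w2 h1 h2.
have hB : `|w1 - w2| < 2 * (r2 / 3).
  rewrite -(subrKA z) (le_lt_trans (ler_normD _ _)) // [`|z - w2|]distrC.
  by rewrite mulr_natl mulr2n ltrD.
have inr w : `|w - w2| <= `|w1 - w2| -> `|w - z| < r2.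
  move=> h; rewrite -(subrKA w2) (le_lt_trans (ler_normD _ _)) //.
  by have := le_lt_trans h hB; lra.
have [|w wz] := @mean_value R m f w2 (w1 - w2).
  move=> w i /inr; rewrite lt_min => /andP[wr _].
  by apply: smooth_on_derivable Sf _; exact: Ur.
rewrite subrK => ->; apply: (le_trans (ler_norm_sum _ _ _)).
apply: (@le_trans _ _ (\sum_i (`|partial i f z| + 1) * `|w1 - w2|)); last first.
  by rewrite mulrDl mul1r mulr_suml lerDl.
apply: ler_sum => i _; rewrite normrM mulrC ler_pM //; last exact: norm_coord_le.
have /inr := wz i; rewrite lt_min => /andP[_ /(Hr i)] h.
rewrite -[partial i f (w i)](subrK (partial i f z)) addrC (le_trans (ler_normD _ _)) //.
by rewrite lerD2l ltW.
Qed.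
End OneSet.
End Calculus2.

(** * Polynomial asymptotics in one variable and multi-indices *)

Section OneDim.
Variable R : realType.

(** Smallness is required only at some points arbitrarily near 0, because [euler_poly] controls just
    the unknown point given by the mean value theorem. The induction gets p(0) = 0 and divides by
    X. *)
Lemma poly_small (M : nat) (p : {poly R}) (C : R) :
  (forall d : R, 0 < d -> exists2 x, 0 < x < d & `|p.[x]| <= C * x ^+ M) ->
  forall k, (k < M)%N -> p`_k = 0.
Proof.
elim: M p => [//|M IH] p H.
have p0 : p.[0] = 0.
  apply/eqP; rewrite -normr_le0; apply/ler_addgt0Pl => e e0; rewrite addr0.
  have e2 : 0 < e / 2 by rewrite divr_gt0.
  have /cvgrPdist_lt/(_ _ e2)/nbhs_ballP[r /= r0 Hr] := @continuous_horner R p 0.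
  have C0 : 0 < `|C| + 1 by rewrite ltr_wpDl.
  have m0 : 0 < Num.min r (Num.min 1 (e / 2 / (`|C| + 1))).
    by rewrite !lt_min r0 ltr01 divr_gt0.
  have [x /andP[x0]] := H _ m0.
  rewrite !lt_min => /and3P[xr x1 xe] Hx.
  have := Hr x; rewrite -ball_normE /ball_/= sub0r normrN gtr0_norm // => /(_ xr) Hd.
  have Hx2 : `|p.[x]| <= e / 2.
    apply: (le_trans Hx); apply: (@le_trans _ _ ((`|C| + 1) * x)); last first.
      by rewrite mulrC -ler_pdivlMr // ltW.
    apply: (@le_trans _ _ (`|C| * x)); last by rewrite ler_pM2r // lerDl.
    apply: (@le_trans _ _ (`|C| * x ^+ M.+1)).
      by rewrite ler_wpM2r ?ler_norm // exprn_ge0 // ltW.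
    by rewrite ler_wpM2l // exprS ler_piMr ?(ltW x0) // exprn_ile1 // ltW.
  rewrite -[p.[0]](subrK p.[x]); apply: (le_trans (ler_normD _ _)).
  by rewrite (splitr e) lerD // ltW.
have /factor_theorem[q pq] : root p 0 by apply/eqP.
rewrite subr0 in pq.
have Hq : forall k, (k < M)%N -> q`_k = 0.
  apply: IH => d d0; have [x xd Hx] := H d d0; exists x => //.
  have x0 : 0 < x by case/andP: xd.
  move: Hx; rewrite pq hornerM hornerX normrM (gtr0_norm x0) exprSr mulrA.
  by rewrite ler_pM2r.
by case=> [|k] kM; rewrite pq coefMX //= Hq.
Qed.

(* Mean value theorem on [[e / 2, e]]: the error made on the derivative is controlled
   at a point comparable to [e]. *)
Lemma euler_poly (h dh : R -> R) (p q : {poly R}) (M : nat) (C e0 : R) : 0 < e0 ->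
  (forall e, 0 < e < e0 -> is_derive e (1 : R) h (dh e)) ->
  (forall e, 0 < e < e0 -> `|h e - p.[e]| <= C * e ^+ M) ->
  (forall e, 0 < e < e0 -> `|e * dh e - q.[e]| <= C * e ^+ M) ->
  forall k, (k < M)%N -> (q - 'X * p^`())`_k = 0.
Proof.
(* The mean value theorem over a length e / 2 bounds |dh - p'| at c by 2 C e^M / (e / 2).
   Multiplying by c <= e gives 4 C e^M, and e <= 2 c turns e^M into 2^M c^M. The last C is the error
   assumed on e dh(e). *)
move=> e00 Hd Hh Hdh; apply: (@poly_small M _ (4 * C * 2 ^+ M + C)) => d d0.
pose e := Num.min d e0 / 2.
have mn : 0 < Num.min d e0 by rewrite lt_min d0.
have [ed ee0] : e < d /\ e < e0.
  have : e < Num.min d e0 by rewrite /e; lra.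
  by rewrite lt_min => /andP[].
have e_gt0 : 0 < e by rewrite divr_gt0.
have Cge : 0 <= C.
  have /Hh := introT andP (conj e_gt0 ee0).
  by move/(le_trans (normr_ge0 _)); rewrite pmulr_lge0 // exprn_gt0.
have e2 : e / 2 <= e by lra.
have [|c /andP[c1 c2] E] := @MVT_derivable R (fun x => h x - p.[x]) (fun x => dh x - p^`().[x]) _ _ e2.
  move=> s /andP[s1 s2].
  have s0e : 0 < s < e0 by apply/andP; split; lra.
  have Hs := Hd s s0e.
  have Hp : is_derive s (1 : R) (horner p) (p^`().[s]).
    apply: DeriveDef; first exact: derivable_horner.
    by rewrite derivE derive1E.
  have -> : (fun x => h x - p.[x]) = h - horner p by [].
  exact: is_deriveB.
have c0 : 0 < c by lra.
have ce0 : 0 < c < e0 by apply/andP; split; lra.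
exists c; first by apply/andP; split; lra.
have r_c : (q - 'X * p^`()).[c] = c * (dh c - p^`().[c]) - (c * dh c - q.[c]).
  by rewrite hornerD hornerN hornerM hornerX; ring.
rewrite r_c mulrDl; apply: (le_trans (ler_normB _ _)); apply: lerD; last exact: Hdh.
have hb1 : `|h e - p.[e]| <= C * e ^+ M by apply: Hh; rewrite e_gt0.
have hb2 : `|h (e / 2) - p.[e / 2]| <= C * e ^+ M.
  apply: le_trans (Hh _ _) _; first by apply/andP; split; lra.
  by rewrite ler_wpM2l // lerXn2r ?nnegrE //; lra.
have hE : `|(dh c - p^`().[c]) * (e - e / 2)| <= 2 * (C * e ^+ M).
  rewrite -E; apply: (le_trans (ler_normB _ _)).
  by rewrite mulr_natl mulr2n lerD.
have eM : e ^+ M <= 2 ^+ M * c ^+ M.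
  by rewrite -exprMn lerXn2r ?nnegrE //; lra.
rewrite normrM (gtr0_norm c0).
have {hE} : `|dh c - p^`().[c]| * (e / 2) <= 2 * (C * e ^+ M).
  move: hE; rewrite normrM (_ : e - e / 2 = e / 2); last by field.
  by rewrite (ger0_norm (_ : 0 <= e / 2)) //; lra.
set D := `|dh c - _| => hE.
have D0 : 0 <= D by exact: normr_ge0.
have hcD : c * D <= 4 * (C * e ^+ M).
  apply: (@le_trans _ _ (2 * (D * (e / 2)))); last by lra.
  have -> : 2 * (D * (e / 2)) = e * D by field.
  by rewrite ler_wpM2r.
apply: (le_trans hcD); rewrite -!mulrA ler_wpM2l // ler_wpM2l //.
Qed.

(** The remainder of [phi 0] has as derivative the remainder of the shifted sequence, so the mean
    value theorem carries a bound K from one to the other on [0, 1]. The factor 1/M! is given up, as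
    only the power of |t| inside K matters later. *)
Lemma taylor_unit (M : nat) (phi : nat -> R -> R) (K : R) :
  (forall k (s : R), 0 <= s <= 1 -> is_derive s (1 : R) (phi k) (phi k.+1 s)) ->
  (forall s : R, 0 <= s <= 1 -> `|phi M s| <= K) ->
  forall s : R, 0 <= s <= 1 ->
  `|phi 0%N s - \sum_(k < M) (k`!%:R)^-1 * s ^+ k * phi k 0| <= K.
Proof.
elim: M phi => [|M IH] phi Hd HK s s01.
  by rewrite big_ord0 subr0; exact: HK.
have K0 : 0 <= K by apply: le_trans (HK 0 _); rewrite ?lexx ?ler01.
have {}IH := IH (fun k => phi k.+1) (fun k => Hd k.+1) HK.
pose P : {poly R} := \sum_(k < M.+1) ((k`!%:R)^-1 * phi k 0) *: 'X^k.
have PE x : P.[x] = \sum_(k < M.+1) (k`!%:R)^-1 * x ^+ k * phi k 0.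
  rewrite horner_sum; apply: eq_bigr => k _.
  by rewrite hornerZ hornerXn mulrAC.
have dP x : P^`().[x] = \sum_(k < M) (k`!%:R)^-1 * x ^+ k * phi k.+1 0.
  rewrite raddf_sum horner_sum big_ord_recl /= derivZ derivXn mulr0n scaler0 horner0 add0r.
  apply: eq_bigr => k _; rewrite derivZ derivXn hornerZ hornerMn hornerXn /= factS natrM.
  rewrite -[x ^+ _ *+ _]mulr_natl invfM.
  have k0 : (k.+1%:R : R) != 0 by rewrite pnatr_eq0.
  have f0 : (k`!%:R : R) != 0 by rewrite pnatr_eq0 -lt0n fact_gt0.
  rewrite /bump /= ?add1n ?add0n; move: (k.+1%:R : R) (k`!%:R : R) k0 f0 => u v u0 v0.
  by field; rewrite u0 v0.
have [s0 s1] := andP s01.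
have [|c /andP[c0 cs] E] := @MVT_derivable R (fun x => phi 0%N x - P.[x])
    (fun x => phi 1%N x - P^`().[x]) 0 s s0.
  move=> x /andP[x0 xs].
  have Hs := Hd 0%N x (introT andP (conj x0 (le_trans xs s1))).
  have Hp : is_derive x (1 : R) (horner P) (P^`().[x]).
    apply: DeriveDef; first exact: derivable_horner.
    by rewrite derivE derive1E.
  have -> : (fun x => phi 0%N x - P.[x]) = phi 0%N - horner P by [].
  exact: is_deriveB.
have P0 : P.[0] = phi 0%N 0.
  rewrite PE big_ord_recl /= expr0 fact0 invr1 !mul1r big1 ?addr0 // => k _.
  by rewrite /bump /= add1n expr0n /= mulr0 mul0r.
rewrite -PE; move: E; rewrite P0 subrr !subr0 => ->.
rewrite normrM (ger0_norm s0) -[leRHS]mulr1 ler_pM //.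
by rewrite dP; apply: IH; rewrite c0 (le_trans cs).
Qed.
End OneDim.

(** * Multi-indices and extraction of coefficients in several variables *)

Section Multiindex.
Variables (R : realType) (N : nat).
Implicit Types a b : mindex N.

Definition madd a b : mindex N := [ffun i => a i + b i]%N.

Lemma mi_abs_madd a b : mi_abs (madd a b) = (mi_abs a + mi_abs b)%N.
Proof. by rewrite /mi_abs -big_split /=; apply: eq_bigr => i _; rewrite ffunE. Qed.

Lemma tpow_madd (t : 'rV[R]_N) a b : tpow t (madd a b) = tpow t a * tpow t b.
Proof. by rewrite /tpow -big_split /=; apply: eq_bigr => i _; rewrite ffunE exprD. Qed.

Lemma tpow_scale (t : 'rV[R]_N) (e : R) a : tpow (e *: t) a = e ^+ mi_abs a * tpow t a.
Proof.
rewrite /tpow /mi_abs -prodrXr -big_split /=.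
by apply: eq_bigr => i _; rewrite mxE exprMn.
Qed.

Lemma tpow_le (t : 'rV[R]_N) a : `|tpow t a| <= `|t| ^+ mi_abs a.
Proof.
rewrite /tpow /mi_abs -prodrXr normr_prod; apply: ler_prod => i _.
by rewrite normr_ge0 normrX lerXn2r ?nnegrE // norm_coord_le.
Qed.

(** Uniqueness of base-K digits, which keeps distinct monomials distinct under Kronecker's
    substitution. *)
Lemma digits_inj (K n : nat) (a b : nat -> nat) :
  (forall i, (i < n)%N -> (a i < K)%N /\ (b i < K)%N) ->
  (\sum_(i < n) a i * K ^ i = \sum_(i < n) b i * K ^ i)%N ->
  forall i, (i < n)%N -> a i = b i.
Proof.
elim: n a b => [//|n IH] a b ab.
have K0 : (0 < K)%N by have [+ _] := ab 0%N isT; case: (K).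
rewrite !big_ord_recl /= expn0 !muln1.
have S (c : nat -> nat) : (\sum_(i < n) c (bump 0 i) * K ^ bump 0 i =
  (\sum_(i < n) c i.+1 * K ^ i) * K)%N.
  by rewrite big_distrl /=; apply: eq_bigr => i _; rewrite /bump add1n expnSr mulnA.
rewrite !S => E.
have [a0 b0] := ab 0%N isT.
have E0 : a 0%N = b 0%N.
  have := congr1 (modn^~ K) E; rewrite /= ![(_ 0%N + _)%N]addnC !modnMDl.
  by rewrite !modn_small.
move: E; rewrite E0 => /addnI /eqP; rewrite eqn_pmul2r // => /eqP E.
case=> [|i] i_n //; apply: (IH (fun i => a i.+1) (fun i => b i.+1)) => // j jn.
exact: ab.
Qed.

(* Kronecker's substitution [t_j = tau ^ (K ^ j)]. *)
Lemma tpow_coef (I : finType) (a : I -> mindex N) (c : I -> R) :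
  (forall t : 'rV[R]_N, \sum_i tpow t (a i) * c i = 0) ->
  forall alpha, \sum_(i | a i == alpha) c i = 0.
Proof.
move=> H alpha.
(* K exceeds every component of [alpha] and of all the [a i], so that these components are base-K
   digits. *)
pose K := (\sum_i mi_abs (a i) + mi_abs alpha).+1.
pose kap (b : mindex N) := (\sum_(j < N) b j * K ^ j)%N.
have aK i j : (a i j < K)%N.
  rewrite ltnS; apply: leq_trans (leq_addr _ _).
  rewrite (bigD1 i) //=; apply: leq_trans (leq_addr _ _).
  by rewrite /mi_abs (bigD1 j) //= leq_addr.
have alK j : (alpha j < K)%N.
  rewrite ltnS; apply: leq_trans (leq_addl _ _).
  by rewrite /mi_abs (bigD1 j) //= leq_addr.
have kinj i : (kap alpha == kap (a i)) = (a i == alpha).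
  apply/eqP/eqP => [|->] // E; apply/ffunP => j.
  pose ext (b : mindex N) k := if insub k is Some j then b j else 0%N.
  have extE (b : mindex N) (k : 'I_N) : ext b k = b k by rewrite /ext valK.
  rewrite -!extE; apply: (@digits_inj K N (ext (a i)) (ext alpha)) => //.
    by move=> k kN; rewrite -[k]/(val (Ordinal kN)) !extE.
  transitivity (kap (a i)); first by apply: eq_bigr => k _; rewrite extE.
  by rewrite -E; apply: eq_bigr => k _; rewrite extE.
pose p : {poly R} := \sum_i c i *: 'X^(kap (a i)).
have p0 (x : R) : p.[x] = 0.
  rewrite -(H (\row_j x ^+ (K ^ j))) horner_sum; apply: eq_bigr => i _.
  rewrite hornerZ hornerXn mulrC; congr (_ * _).
  rewrite /tpow /kap -prodrXr; apply: eq_bigr => j _.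
  by rewrite mxE -exprM mulnC.
have pz : p`_(kap alpha) = 0.
  apply: (@poly_small R (kap alpha).+1 p 0) => // d d0; exists (d / 2).
    by apply/andP; split; lra.
  by rewrite p0 normr0 mul0r.
rewrite -[RHS]pz coef_sum [LHS]big_mkcond; apply: eq_bigr => i _.
by rewrite coefZ coefXn kinj; case: eqP => _; rewrite ?mulr1 ?mulr0.
Qed.
End Multiindex.

(** * Commuting a tower of operators past the powers of Y, in an abstract group *)

Section ExpDerivative.
Variables (T : zmodType) (P : T -> Prop) (Y : T -> T) (B : nat -> T -> T).
Hypothesis P0 : P 0.
Hypothesis PD : forall u v, P u -> P v -> P (u + v).
Hypothesis PY : forall u, P u -> P (Y u).
Hypothesis PB : forall q u, P u -> P (B q u).
Hypothesis YD : forall u v, P u -> P v -> Y (u + v) = Y u + Y v.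
Hypothesis BY : forall q u, P u -> B q (Y u) = Y (B q u) + B q.+1 u.

Lemma P_iter k u : P u -> P (iter k Y u).
Proof. by move=> Pu; elim: k => //= k IH; exact: PY. Qed.

Lemma P_muln u c : P u -> P (u *+ c).
Proof. by move=> Pu; elim: c => [|c IH]; rewrite ?mulr0n // mulrS; exact: PD. Qed.

Lemma P_sum (I : Type) (r : seq I) (F : I -> T) : (forall i, P (F i)) -> P (\sum_(i <- r) F i).
Proof. by move=> PF; elim: r => [|i r IH]; rewrite ?big_nil // big_cons; exact: PD. Qed.

Lemma Y_0 : Y 0 = 0.
Proof. by apply: (addrI (Y 0)); rewrite addr0 -YD // addr0. Qed.

Lemma Y_muln u c : P u -> Y (u *+ c) = Y u *+ c.
Proof.
move=> Pu; elim: c => [|c IH]; first by rewrite !mulr0n Y_0.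
by rewrite !mulrS YD // ?IH //; exact: P_muln.
Qed.

Lemma Y_sum (I : Type) (r : seq I) (F : I -> T) : (forall i, P (F i)) ->
  Y (\sum_(i <- r) F i) = \sum_(i <- r) Y (F i).
Proof.
move=> PF; elim: r => [|i r IH]; first by rewrite !big_nil Y_0.
by rewrite !big_cons YD // ?IH //; exact: P_sum.
Qed.

(** [BY] says [B q, Y] = B (q+1) on the elements satisfying [P] (smooth functions in the
    application). Moving B to the right through Y^k therefore obeys a Leibniz formula, proved by
    Pascal's rule. *)
Lemma B_iter k r u : P u ->
  B r (iter k Y u) = \sum_(q < k.+1) iter (k - q) Y (B (r + q)%N u) *+ 'C(k, q).
Proof.
move=> Pu; elim: k r => [|k IH] r.
  by rewrite big_ord1 /= addn0 bin0 mulr1n.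
rewrite iterS BY; last exact: P_iter.
rewrite !IH Y_sum; last by move=> q; apply/P_muln/P_iter/PB.
pose F q := iter (k.+1 - q) Y (B (r + q)%N u).
transitivity (\sum_(q < k.+2) F q *+ 'C(k, q) + \sum_(q < k.+1) F q.+1 *+ 'C(k, q)).
  congr (_ + _); last by apply: eq_bigr => q _; rewrite /F subSS addnS addSn.
  rewrite [RHS]big_ord_recr /= bin_small // mulr0n addr0.
  apply: eq_bigr => q _; rewrite Y_muln; last exact/P_iter/PB.
  by rewrite -iterS /F subSn // -ltnS.
rewrite big_ord_recl /= -addrA -big_split /= [RHS]big_ord_recl /= !bin0.
congr (_ + _); apply: eq_bigr => q _.
by rewrite /bump /= add1n binS mulrnDr.
Qed.

(* With [E] a derivation such that [[E, Y] = B 0] and [E u = 0], this is the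
   inductive step computing [E (Y ^ k u)]. *)
Definition expB k u := \sum_(q < k) iter (k - q.+1) Y (B q u) *+ 'C(k, q.+1).

(** [B_iter] expands B 0 Y^k, and C(k, q+1) + C(k, q) = C(k+1, q+1) merges the two sums. *)
Lemma expB_S k u : P u -> Y (expB k u) + B 0%N (iter k Y u) = expB k.+1 u.
Proof.
move=> Pu; rewrite /expB Y_sum; last by move=> q; apply/P_muln/P_iter/PB.
rewrite (@B_iter k 0) //.
transitivity (\sum_(q < k.+1) iter (k - q) Y (B q u) *+ 'C(k, q.+1)
   + \sum_(q < k.+1) iter (k - q) Y (B q u) *+ 'C(k, q)).
  congr (_ + _).
  rewrite [RHS]big_ord_recr /= bin_small // mulr0n addr0.
  apply: eq_bigr => q _; rewrite Y_muln; last exact/P_iter/PB.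
  by rewrite -iterS -subSn.
rewrite -big_split /=; apply: eq_bigr => q _.
by rewrite subSS binS mulrnDr.
Qed.
End ExpDerivative.

(** * Differential operators depending polynomially on the parameter *)

Section Operators.
Variables (R : realType) (n : nat).

Definition nball m (r : R) : set 'rV[R]_m := [set x | `|x| < r].

Lemma open_nball m (r : R) : open (@nball m r).
Proof.
apply: (@open_comp _ _ (fun x : 'rV[R]_m => `|x|) [set y : R | y < r]).
  by move=> x _; exact: norm_continuous.
exact: open_lt.
Qed.

Definition smooth_field_on m (U : set 'rV[R]_m) (Z : 'rV[R]_m -> 'rV[R]_n) :=
  forall i, smooth_on U (fun x => Z x 0 i).

Variable r : R.
Local Notation U := (@nball n r).
Local Notation Uo := (@open_nball n r).

(* The value [0] outside the ball makes identities between these operators hold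
   as equalities of functions. *)
Definition lie_derivative (Z : VF R n) (f : 'rV[R]_n -> R) : 'rV[R]_n -> R :=
  fun x => if `|x| < r then \sum_i Z x 0 i * partial i f x else 0.

Lemma lie_derivativeE Z f x : U x -> lie_derivative Z f x = \sum_i Z x 0 i * partial i f x.
Proof. by rewrite /nball /lie_derivative /= => ->. Qed.

Lemma lie_derivative_eq Z f g : (forall x, U x -> f x = g x) -> lie_derivative Z f = lie_derivative Z g.
Proof.
move=> fg; apply/funext => x; rewrite /lie_derivative; case: ifP => // Ux.
by apply: eq_bigr => i _; rewrite (partial_eq Uo i fg Ux).
Qed.

Lemma lie_derivative_smooth Z f : smooth_field_on U Z -> smooth_on U f -> smooth_on U (lie_derivative Z f).
Proof.
move=> SZ Sf.
apply: (smooth_on_eq Uo (f := fun x => \sum_i Z x 0 i * partial i f x)).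
  by move=> x Ux; rewrite lie_derivativeE.
exact: (smooth_on_sum Uo (fun i => smooth_on_mul Uo (SZ i) (smooth_on_partial i Sf))).
Qed.

Lemma lie_derivative_sum Z (I : finType) (c : I -> R) (f : I -> 'rV[R]_n -> R) x :
  (forall i, smooth_on U (f i)) ->
  lie_derivative Z (fun x => \sum_i c i * f i x) x = \sum_i c i * lie_derivative Z (f i) x.
Proof.
move=> Sf; rewrite /lie_derivative; case: ifP => Ux; last first.
  by rewrite big1 // => i _; rewrite mulr0.
under [RHS]eq_bigr do rewrite mulr_sumr.
rewrite exchange_big /=; apply: eq_bigr => j _.
rewrite (partial_sum Uo j (fun i => smooth_on_scale Uo (c i) (Sf i)) Ux).
rewrite mulr_sumr; apply: eq_bigr => i _.
by rewrite (partial_scale Uo (c i) j (Sf i) Ux) mulrCA.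
Qed.

Lemma lie_derivative_add Z f g : smooth_on U f -> smooth_on U g ->
  lie_derivative Z (fun x => f x + g x) = (fun x => lie_derivative Z f x + lie_derivative Z g x).
Proof.
move=> Sf Sg; apply/funext => x; rewrite /lie_derivative; case: ifP => Ux; last by rewrite addr0.
rewrite -big_split /=; apply: eq_bigr => i _.
by rewrite (partial_add (U := U)) // mulrDr.
Qed.

Lemma derive_coord m (V : set 'rV[R]_m) (Z : 'rV[R]_m -> 'rV[R]_n) x v :
  open V -> smooth_field_on V Z -> V x ->
  derivable Z x v /\ forall i, derive Z x v 0 i = \sum_j v 0 j * partial j (fun x => Z x 0 i) x.
Proof.
move=> Vo SZ Vx.
have d : derivable Z x v.
  apply/derivable_mxP => i j; rewrite ord1.
  by have [] := smooth_on_derive Vo v (SZ j) Vx.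
split=> // i; rewrite derive_mx // mxE.
by have [_] := smooth_on_derive Vo v (SZ i) Vx.
Qed.

Lemma lie_coord X Y x i : smooth_field_on U X -> smooth_field_on U Y -> U x ->
  lie X Y x 0 i = lie_derivative X (fun x => Y x 0 i) x - lie_derivative Y (fun x => X x 0 i) x.
Proof.
move=> SX SY Ux; rewrite !lie_derivativeE // /lie !mxE.
have [_ ->] := derive_coord (X x) Uo SY Ux.
by have [_ ->] := derive_coord (Y x) Uo SX Ux.
Qed.

Lemma lie_smooth X Y : smooth_field_on U X -> smooth_field_on U Y -> smooth_field_on U (lie X Y).
Proof.
move=> SX SY i.
apply: (smooth_on_eq Uo (f := fun x => lie_derivative X (fun x => Y x 0 i) x - lie_derivative Y (fun x => X x 0 i) x)).
  by move=> x Ux; rewrite lie_coord.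
by apply: (smooth_on_sub Uo); apply: lie_derivative_smooth.
Qed.

(** The composite splits into a first-order and a second-order part. The latter is symmetric in X
    and Y because partial derivatives commute, so it cancels in the commutator. *)
Lemma lie_derivative_Dop X Y f x : smooth_field_on U X -> smooth_field_on U Y -> smooth_on U f -> U x ->
  lie_derivative X (lie_derivative Y f) x =
    \sum_i lie_derivative X (fun x => Y x 0 i) x * partial i f x +
    \sum_i \sum_j X x 0 i * Y x 0 j * partial i (partial j f) x.
Proof.
move=> SX SY Sf Ux; rewrite lie_derivativeE //.
have E i : partial i (lie_derivative Y f) x =
    \sum_j (Y x 0 j * partial i (partial j f) x + partial j f x * partial i (fun x => Y x 0 j) x).
  rewrite (partial_eq Uo i (g := fun x => \sum_j Y x 0 j * partial j f x)) //; last first.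
    by move=> y Uy; rewrite lie_derivativeE.
  rewrite (partial_sum Uo i (fun j => smooth_on_mul Uo (SY j) (smooth_on_partial j Sf)) Ux).
  by apply: eq_bigr => j _; rewrite (partial_mul i (SY j) (smooth_on_partial j Sf) Ux).
under eq_bigr do rewrite E mulr_sumr.
under eq_bigr do under eq_bigr do rewrite mulrDr.
under eq_bigr do rewrite big_split /=.
rewrite big_split /= addrC; congr (_ + _); last first.
  by apply: eq_bigr => i _; apply: eq_bigr => j _; rewrite mulrA.
rewrite exchange_big /=; apply: eq_bigr => j _.
by rewrite lie_derivativeE // mulr_suml; apply: eq_bigr => i _; rewrite mulrA mulrAC.
Qed.

Lemma lie_derivative_comm X Y f x : smooth_field_on U X -> smooth_field_on U Y -> smooth_on U f ->
  lie_derivative X (lie_derivative Y f) x = lie_derivative Y (lie_derivative X f) x + lie_derivative (lie X Y) f x.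
Proof.
move=> SX SY Sf.
have [Ux|Ux] := boolP (`|x| < r); last by rewrite /lie_derivative (negbTE Ux) addr0.
rewrite !lie_derivative_Dop // (lie_derivativeE (lie X Y)) //.
have -> : \sum_i \sum_j X x 0 i * Y x 0 j * partial i (partial j f) x =
          \sum_i \sum_j Y x 0 i * X x 0 j * partial i (partial j f) x.
  rewrite exchange_big /=; apply: eq_bigr => i _; apply: eq_bigr => j _.
  by rewrite (partial_comm Uo j i Sf Ux) // [X _ _ _ * _]mulrC.
rewrite addrAC; congr (_ + _); rewrite -big_split /=; apply: eq_bigr => i _.
by rewrite lie_coord // mulrBl addrC subrK.
Qed.

Variable N : nat.

(** A polynomial in t with coefficients in T, as a list of monomials in which an exponent may occur
    several times. Sums and products are then disjoint unions and products of index types, and like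
    terms are collected only at the end. *)
Record fam (T : Type) := Fam { ix : finType; ex : ix -> mindex N; va : ix -> T }.

Local Notation fun2 := ('rV[R]_N -> 'rV[R]_n -> R).

Definition smooth_param (u : fun2) := forall t, smooth_on U (u t).

Definition family_op (F : fam (VF R n)) (u : fun2) : fun2 :=
  fun t x => \sum_(i : ix F) tpow t (ex i) * lie_derivative (va i) (u t) x.

Definition smooth_family (F : fam (VF R n)) := forall i : ix F, smooth_field_on U (va i).

Lemma smooth_param_family_op F u : smooth_family F -> smooth_param u -> smooth_param (family_op F u).
Proof.
move=> SF Su t; apply: (smooth_on_sum Uo (f := fun i x => tpow t (ex i) * lie_derivative (va i) (u t) x)) => i.
by apply: (smooth_on_scale Uo); apply: lie_derivative_smooth.
Qed.

Lemma smooth_param_add u v : smooth_param u -> smooth_param v -> smooth_param (u + v).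
Proof. by move=> Su Sv t; exact: (smooth_on_add Uo (Su t) (Sv t)). Qed.

Lemma smooth_param_0 : smooth_param 0.
Proof. by move=> t; exact: (smooth_on_cst Uo 0). Qed.

Lemma smooth_param_scale (c : R) u : smooth_param u -> smooth_param (c *: u).
Proof. by move=> Su t; exact: (smooth_on_scale Uo c (Su t)). Qed.

Lemma family_op_add F u v : smooth_param u -> smooth_param v -> family_op F (u + v) = family_op F u + family_op F v.
Proof.
move=> Su Sv; apply/funext => t; apply/funext => x.
rewrite -[RHS]/(family_op F u t x + family_op F v t x) /family_op -big_split /=; apply: eq_bigr => i _.
have -> : (u + v) t = (fun x => u t x + v t x) by [].
by rewrite lie_derivative_add // mulrDr.
Qed.

Lemma family_op_scale F c u : smooth_param u -> family_op F (c *: u) = c *: family_op F u.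
Proof.
move=> Su; apply/funext => t; apply/funext => x.
rewrite -[RHS]/(c * family_op F u t x) /family_op mulr_sumr; apply: eq_bigr => i _.
rewrite mulrCA; congr (_ * _).
have := @lie_derivative_sum (va i) unit (fun=> c) (fun=> u t) x (fun=> Su t).
rewrite big_const card_unit /= addr0 => <-.
congr (lie_derivative _ _ _); apply/funext => y; rewrite big_const card_unit /= addr0.
by [].
Qed.

Definition lieF (F G : fam (VF R n)) : fam (VF R n) :=
  @Fam _ (ix F * ix G)%type (fun p => madd (ex p.1) (ex p.2)) (fun p => lie (va p.1) (va p.2)).

Lemma smooth_family_lieF F G : smooth_family F -> smooth_family G -> smooth_family (lieF F G).
Proof. by move=> SF SG [i j]; exact: lie_smooth. Qed.

Lemma family_op_family_op F G u t x : smooth_family F -> smooth_family G -> smooth_param u ->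
  family_op F (family_op G u) t x = \sum_(i : ix F) \sum_(j : ix G) tpow t (ex i) * tpow t (ex j) *
    lie_derivative (va i) (lie_derivative (va j) (u t)) x.
Proof.
move=> SF SG Su; apply: eq_bigr => i _.
rewrite (@lie_derivative_sum (va i) _ (fun j => tpow t (ex j)) (fun j => lie_derivative (va j) (u t))).
  by rewrite mulr_sumr; apply: eq_bigr => j _; rewrite mulrA.
by move=> j; exact: lie_derivative_smooth.
Qed.

Lemma family_op_comm F G u : smooth_family F -> smooth_family G -> smooth_param u ->
  family_op F (family_op G u) = family_op G (family_op F u) + family_op (lieF F G) u.
Proof.
move=> SF SG Su; apply/funext => t; apply/funext => x.
rewrite -[RHS]/(family_op G (family_op F u) t x + family_op (lieF F G) u t x) !family_op_family_op //.
rewrite [X in _ = X + _]exchange_big /= /family_op /=.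
rewrite -(pair_bigA _ (fun (i : ix F) (j : ix G) => tpow t (madd (ex i) (ex j)) * lie_derivative (lie (va i) (va j)) (u t) x)) /=.
rewrite -big_split /=; apply: eq_bigr => i _; rewrite -big_split /=.
apply: eq_bigr => j _; rewrite lie_derivative_comm // tpow_madd mulrDr.
by rewrite [tpow t (ex j) * _]mulrC.
Qed.

Definition eval_family (F : fam ('rV[R]_n -> R)) : fun2 :=
  fun t x => \sum_(i : ix F) tpow t (ex i) * va i x.

(** An exact polynomial representation, in which every monomial has degree at least m: the algebraic
    form of O(|t|^m). *)
Definition has_order (m : nat) (u : fun2) := exists F : fam ('rV[R]_n -> R),
  [/\ forall i : ix F, smooth_on U (va i), forall i : ix F, (m <= mi_abs (ex i))%N &
      forall t x, U x -> u t x = eval_family F t x].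

Lemma has_order_smooth m u : has_order m u -> smooth_param u.
Proof.
move=> [F [SF _ E]] t; apply: (smooth_on_eq Uo (f := eval_family F t)); first by move=> x Ux; rewrite E.
by apply: (smooth_on_sum Uo (f := fun i x => tpow t (ex i) * va i x)) => i; exact: (smooth_on_scale Uo).
Qed.

Lemma has_order_le m1 m2 u : (m1 <= m2)%N -> has_order m2 u -> has_order m1 u.
Proof.
move=> m12 [F [SF oF E]]; exists F; split=> // i; exact: leq_trans (oF i).
Qed.

Definition sumF T (F G : fam T) : fam T :=
  @Fam _ (ix F + ix G)%type
    (fun s => match s with inl i => ex i | inr j => ex j end)
    (fun s => match s with inl i => va i | inr j => va j end).

Lemma has_order_add m u v : has_order m u -> has_order m v -> has_order m (u + v).
Proof.
move=> [F [SF oF EF]] [G [SG oG EG]]; exists (sumF F G); split; try by case.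
move=> t x Ux; rewrite -[LHS]/(u t x + v t x) EF // EG //.
by rewrite {3}/eval_family /= big_sumType.
Qed.

Lemma has_order_scale m c u : has_order m u -> has_order m (c *: u).
Proof.
move=> [F [SF oF EF]]; exists (@Fam _ (ix F) (@ex _ F) (fun i x => c * va i x)).
split=> // [i|t x Ux]; first exact: (smooth_on_scale Uo).
rewrite -[LHS]/(c * u t x) EF // mulr_sumr; apply: eq_bigr => i _ /=.
by rewrite mulrCA.
Qed.

Lemma has_order_0 m : has_order m 0.
Proof.
exists (@Fam _ void (fun i => match i with end) (fun i => match i with end)).
by split=> [[]|[]|t x _]; rewrite /eval_family big1 //; case.
Qed.

Lemma has_order_sum m (I : Type) (s : seq I) (P : pred I) (F : I -> fun2) :
  (forall i, P i -> has_order m (F i)) -> has_order m (\sum_(i <- s | P i) F i).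
Proof. by move=> PF; apply: big_ind => //; [exact: has_order_0|exact: has_order_add]. Qed.

Lemma has_order_family_op p m F u : smooth_family F -> (forall i : ix F, (p <= mi_abs (ex i))%N) ->
  has_order m u -> has_order (p + m) (family_op F u).
Proof.
move=> SF oF [G [SG oG EG]].
exists (@Fam _ (ix F * ix G)%type (fun q => madd (ex q.1) (ex q.2))
   (fun q => lie_derivative (va q.1) (va q.2))); split => /=.
- by move=> [i j]; exact: lie_derivative_smooth.
- by move=> [i j]; rewrite mi_abs_madd leq_add.
move=> t x Ux; rewrite /family_op /eval_family /=.
rewrite -(pair_bigA _ (fun (i : ix F) (j : ix G) => tpow t (madd (ex i) (ex j)) * lie_derivative (va i) (va j) x)) /=.
apply: eq_bigr => i _; rewrite (lie_derivative_eq _ (EG t)).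
rewrite (@lie_derivative_sum (va i) _ (fun j => tpow t (ex j)) (fun j => va j)) //.
by rewrite mulr_sumr; apply: eq_bigr => j _; rewrite mulrA tpow_madd.
Qed.

Lemma has_order_poly m u t x : has_order m u -> U x -> exists p : {poly R},
  (forall e, u (e *: t) x = p.[e]) /\ forall k, (k < m)%N -> p`_k = 0.
Proof.
move=> [F [SF oF EF]] Ux.
exists (\sum_(i : ix F) (tpow t (ex i) * va i x) *: 'X^(mi_abs (ex i))); split.
  move=> e; rewrite EF // horner_sum; apply: eq_bigr => i _.
  by rewrite hornerZ hornerXn tpow_scale -mulrA mulrC.
move=> k km; rewrite coef_sum big1 // => i _.
by rewrite coefZ coefXn ltn_eqF ?mulr0 // (leq_trans km).
Qed.

Lemma fin_min (I : finType) (rho : I -> R) : (forall i, 0 < rho i) ->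
  exists2 d : R, 0 < d & forall i, d <= rho i.
Proof.
move=> H; exists (\big[Num.min/1]_i rho i); first by apply: lt_bigmin.
by move=> i; exact: bigmin_le.
Qed.

Lemma has_order_bound m u x : has_order m u -> U x -> exists2 d : R, 0 < d &
  exists2 C : R, 0 < C & forall t z, `|z - x| < d -> `|t| <= 1 -> `|u t z| <= C * `|t| ^+ m.
Proof.
move=> [F [SF oF EF]] Ux.
have H (i : ix F) : exists rC : R * R, [/\ 0 < rC.1, 0 < rC.2 &
   forall w, `|w - x| < rC.1 -> `|va i w| <= rC.2].
  by have [a a0 [C C0 Hw]] := smooth_on_bounded (SF i) Ux; exists (a, C).
have [rC {}H] := choice H.
have [d d0 Hd] := @fin_min (ix F) (fun i => (rC i).1) (fun i => let: And3 a _ _ := H i in a).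
have [d2 d20 Hd2] := open_dist Uo Ux.
exists (Num.min d d2); first by rewrite lt_min d0.
exists (\sum_i (rC i).2 + 1).
  by rewrite ltr_wpDl // sumr_ge0 // => i _; have [_ /ltW] := H i.
move=> t z; rewrite lt_min => /andP[zd zd2] t1.
rewrite EF; last exact: Hd2.
apply: (le_trans (ler_norm_sum _ _ _)).
apply: (@le_trans _ _ (\sum_i (rC i).2 * `|t| ^+ m)); last first.
  by rewrite -mulr_suml ler_wpM2r ?exprn_ge0 // lerDl.
apply: ler_sum => i _; rewrite normrM mulrC; have [_ _ Hi] := H i.
apply: ler_pM => //; first by apply: Hi; exact: lt_le_trans zd _.
apply: le_trans (tpow_le _ _) _; exact: ler_wiXn2l.
Qed.

Lemma has_order_Lipschitz m u x : has_order m u -> U x -> exists2 d : R, 0 < d &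
  exists2 C : R, 0 < C & forall t z1 z2, `|z1 - x| < d -> `|z2 - x| < d -> `|t| <= 1 ->
  `|u t z1 - u t z2| <= C * `|z1 - z2|.
Proof.
move=> [F [SF oF EF]] Ux.
have H (i : ix F) : exists rC : R * R, [/\ 0 < rC.1, 0 < rC.2 &
   forall w1 w2, `|w1 - x| < rC.1 -> `|w2 - x| < rC.1 ->
    `|va i w1 - va i w2| <= rC.2 * `|w1 - w2|].
  by have [a a0 [C C0 Hw]] := smooth_on_Lipschitz Uo (SF i) Ux; exists (a, C).
have [rC {}H] := choice H.
have [d d0 Hd] := @fin_min (ix F) (fun i => (rC i).1) (fun i => let: And3 a _ _ := H i in a).
have [d2 d20 Hd2] := open_dist Uo Ux.
exists (Num.min d d2); first by rewrite lt_min d0.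
exists (\sum_i (rC i).2 + 1).
  by rewrite ltr_wpDl // sumr_ge0 // => i _; have [_ /ltW] := H i.
move=> t z1 z2; rewrite !lt_min => /andP[z1d z1d2] /andP[z2d z2d2] t1.
rewrite !EF; [|exact: Hd2|exact: Hd2].
rewrite /eval_family -sumrB; apply: (le_trans (ler_norm_sum _ _ _)).
apply: (@le_trans _ _ (\sum_i (rC i).2 * `|z1 - z2|)); last first.
  by rewrite -mulr_suml ler_wpM2r // lerDl.
apply: ler_sum => i _; rewrite -mulrBr normrM; have [_ _ Hi] := H i.
rewrite -[leRHS]mul1r; apply: ler_pM => //.
  by apply: le_trans (tpow_le _ _) _; exact: exprn_ile1.
by apply: Hi; [exact: lt_le_trans z1d _|exact: lt_le_trans z2d _].
Qed.

(** v is E u, read off monomial by monomial. It is a relation because one family has to represent u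
    and, with weights |a|, also v. *)
Definition euler_pair (u v : fun2) := exists F : fam ('rV[R]_n -> R),
  [/\ forall i : ix F, smooth_on U (va i),
      forall t x, U x -> u t x = eval_family F t x &
      forall t x, U x -> v t x = \sum_(i : ix F) (mi_abs (ex i))%:R * (tpow t (ex i) * va i x)].

Lemma euler_pair_cst f : smooth_on U f -> euler_pair (fun=> f) 0.
Proof.
move=> Sf; exists (@Fam _ unit (fun=> [ffun=> 0%N]) (fun=> f)).
have a0 : mi_abs ([ffun=> 0%N] : mindex N) = 0%N.
  by rewrite /mi_abs big1 // => i _; rewrite ffunE.
split=> // t x Ux.
  rewrite /eval_family /= big_const card_unit /= addr0 /tpow big1 ?mul1r // => i _.
  by rewrite ffunE expr0.
by rewrite /= big1 // => i _; rewrite a0 mul0r.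
Qed.

Lemma euler_pair_add u1 v1 u2 v2 : euler_pair u1 v1 -> euler_pair u2 v2 -> euler_pair (u1 + u2) (v1 + v2).
Proof.
move=> [F [SF EF EF']] [G [SG EG EG']]; exists (sumF F G); split; first by case.
  by move=> t x Ux; rewrite -[LHS]/(u1 t x + u2 t x) EF // EG // {3}/eval_family /= big_sumType.
by move=> t x Ux; rewrite -[LHS]/(v1 t x + v2 t x) EF' // EG' // big_sumType.
Qed.

Lemma euler_pair_scale c u v : euler_pair u v -> euler_pair (c *: u) (c *: v).
Proof.
move=> [F [SF EF EF']]; exists (@Fam _ (ix F) (@ex _ F) (fun i x => c * va i x)).
split=> [i|t x Ux|t x Ux]; first exact: (smooth_on_scale Uo).
  rewrite -[LHS]/(c * u t x) EF // mulr_sumr; apply: eq_bigr => i _ /=.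
  by rewrite mulrCA.
rewrite -[LHS]/(c * v t x) EF' // mulr_sumr; apply: eq_bigr => i _ /=.
by rewrite mulrCA; congr (_ * _); rewrite mulrCA.
Qed.

Lemma euler_pair_sum (I : Type) (s : seq I) (F G : I -> fun2) :
  (forall i, euler_pair (F i) (G i)) -> euler_pair (\sum_(i <- s) F i) (\sum_(i <- s) G i).
Proof.
move=> H; elim: s => [|i s IH]; last by rewrite !big_cons; exact: euler_pair_add.
rewrite !big_nil; exact: (euler_pair_cst (smooth_on_cst Uo 0)).
Qed.

Definition eulerF (F : fam (VF R n)) : fam (VF R n) :=
  @Fam _ (ix F) (@ex _ F) (fun i x => (mi_abs (ex i))%:R *: va i x).

Lemma smooth_family_eulerF F : smooth_family F -> smooth_family (eulerF F).
Proof.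
move=> SF i j; apply: (smooth_on_eq Uo) (smooth_on_scale Uo (mi_abs (ex i))%:R (SF i j)) => x _.
by rewrite /= mxE.
Qed.

(** Leibniz rule E (Y u) = Y (E u) + (E Y) u: in each product of monomials the degrees add. *)
Lemma euler_pair_family_op F u v : smooth_family F -> euler_pair u v -> euler_pair (family_op F u) (family_op F v + family_op (eulerF F) u).
Proof.
move=> SF [G [SG EG EG']].
exists (@Fam _ (ix F * ix G)%type (fun q => madd (ex q.1) (ex q.2))
   (fun q => lie_derivative (va q.1) (va q.2))); split => /=.
- by move=> [i j]; exact: lie_derivative_smooth.
- move=> t x Ux; rewrite /family_op /eval_family /=.
  rewrite -(pair_bigA _ (fun (i : ix F) (j : ix G) => tpow t (madd (ex i) (ex j)) * lie_derivative (va i) (va j) x)) /=.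
  apply: eq_bigr => i _; rewrite (lie_derivative_eq _ (EG t)).
  rewrite (@lie_derivative_sum (va i) _ (fun j => tpow t (ex j)) (fun j => va j)) //.
  by rewrite mulr_sumr; apply: eq_bigr => j _; rewrite mulrA tpow_madd.
move=> t x Ux; rewrite -[LHS]/(family_op F v t x + family_op (eulerF F) u t x) /family_op /=.
rewrite -(pair_bigA _ (fun (i : ix F) (j : ix G) => (mi_abs (madd (ex i) (ex j)))%:R *
   (tpow t (madd (ex i) (ex j)) * lie_derivative (va i) (va j) x))) /=.
rewrite -big_split /=; apply: eq_bigr => i _.
have -> : lie_derivative (va i) (v t) x =
    \sum_(j : ix G) ((mi_abs (ex j))%:R * tpow t (ex j)) * lie_derivative (va i) (va j) x.
  rewrite -(@lie_derivative_sum (va i) _ (fun j => (mi_abs (ex j))%:R * tpow t (ex j)) (fun j => va j)) //.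
  rewrite (@lie_derivative_eq _ _ (fun x => \sum_(j : ix G) (mi_abs (ex j))%:R * tpow t (ex j) * va j x)) //.
  by move=> y Uy; rewrite EG' //; apply: eq_bigr => j _; rewrite mulrA.
have -> : lie_derivative (fun x => (mi_abs (ex i))%:R *: va i x) (u t) x =
    \sum_(j : ix G) ((mi_abs (ex i))%:R * tpow t (ex j)) * lie_derivative (va i) (va j) x.
  transitivity ((mi_abs (ex i))%:R * lie_derivative (va i) (u t) x).
    rewrite !lie_derivativeE // mulr_sumr; apply: eq_bigr => j _.
    by rewrite mxE mulrA.
  rewrite (lie_derivative_eq _ (EG t)).
  rewrite (@lie_derivative_sum (va i) _ (fun j => tpow t (ex j)) (fun j => va j)) // mulr_sumr.
  by apply: eq_bigr => j _; rewrite mulrA.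
rewrite !mulr_sumr -big_split /=; apply: eq_bigr => j _.
rewrite mi_abs_madd tpow_madd natrD; ring.
Qed.

(** On a ray E becomes X d/dX, the form in which [euler_poly] detects it. *)
Lemma euler_pair_poly u v t x : euler_pair u v -> U x -> exists p : {poly R},
  forall e, u (e *: t) x = p.[e] /\ v (e *: t) x = ('X * p^`()).[e].
Proof.
move=> [F [SF EF EF']] Ux.
exists (\sum_(i : ix F) (tpow t (ex i) * va i x) *: 'X^(mi_abs (ex i))) => e; split.
  rewrite EF // horner_sum; apply: eq_bigr => i _.
  by rewrite hornerZ hornerXn tpow_scale -mulrA mulrC.
rewrite EF' // hornerM hornerX raddf_sum horner_sum mulr_sumr; apply: eq_bigr => i _ /=.
rewrite derivZ derivXn hornerZ hornerMn hornerXn tpow_scale -[_ *+ mi_abs _]mulr_natl.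
case: (mi_abs (ex i)) => [|k]; first by rewrite !mul0r !mulr0.
by rewrite /= exprS; ring.
Qed.
End Operators.

(** * Coordinates and curves *)

Section Coordinates.
Variables (R : realType).

(** The hypothesis on [io] says that a move along coordinate j becomes a move along coordinate
    [sg j]. It covers both ways of freezing one of the two arguments of a function of (t, x). *)
Lemma iter_partial_affine (V : normedModType R) a b (sg : 'I_a -> 'I_b)
    (io : 'rV[R]_a -> 'rV[R]_b) (F : 'rV[R]_b -> V) s z :
  (forall h j z, io (h *: coord_vec R j + z) = h *: coord_vec R (sg j) + io z) ->
  iter_partial s (fun z => F (io z)) z = iter_partial (map sg s) F (io z).
Proof.
move=> H; elim: s z => [//|j s IH] z /=.
rewrite (funext IH) /derive; congr (lim _).
have -> // : (fun h : R => h^-1 *: (iter_partial (map sg s) F (io (h *: coord_vec R j + z))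
    - iter_partial (map sg s) F (io z))) =
  (fun h : R => h^-1 *: (iter_partial (map sg s) F (h *: coord_vec R (sg j) + io z)
    - iter_partial (map sg s) F (io z))).
by apply/funext => h; rewrite H.
Qed.

Lemma derivable_affine (V : normedModType R) a b (sg : 'I_a -> 'I_b)
    (io : 'rV[R]_a -> 'rV[R]_b) (F : 'rV[R]_b -> V) j z :
  (forall h j z, io (h *: coord_vec R j + z) = h *: coord_vec R (sg j) + io z) ->
  derivable F (io z) (coord_vec R (sg j)) ->
  derivable (fun z => F (io z)) z (coord_vec R j).
Proof.
move=> H; rewrite /derivable.
have -> // : (fun h : R => h^-1 *: (F (io (h *: coord_vec R j + z)) - F (io z))) =
  (fun h : R => h^-1 *: (F (h *: coord_vec R (sg j) + io z) - F (io z))).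
by apply/funext => h; rewrite H.
Qed.

Lemma smooth_on_affine a b (sg : 'I_a -> 'I_b) (io : 'rV[R]_a -> 'rV[R]_b)
    (U : set 'rV[R]_a) (V : set 'rV[R]_b) (F : 'rV[R]_b -> R) :
  (forall h j z, io (h *: coord_vec R j + z) = h *: coord_vec R (sg j) + io z) ->
  continuous io -> (forall z, U z -> V (io z)) -> smooth_on V F -> smooth_on U (fun z => F (io z)).
Proof.
move=> H ic UV SF s z Uz; have [c d] := SF (map sg s) _ (UV _ Uz).
have -> : iter_partial s (fun z => F (io z)) = (fun z => iter_partial (map sg s) F (io z)).
  by apply/funext => y; exact: iter_partial_affine.
split; first exact: (continuous_comp (ic z) c).
by move=> i; apply: derivable_affine.
Qed.

Section RowMx.
Variables (N n : nat).

Lemma coord_vec_lshift (j : 'I_N) : coord_vec R (lshift n j) = row_mx (coord_vec R j) 0.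
Proof.
apply/rowP => k; rewrite /coord_vec !mxE /=.
case: splitP => l kl; rewrite !mxE //=.
  by congr (_%:R); rewrite -!(inj_eq val_inj) /= kl.
by case: eqP => // E; move: kl; rewrite E /=; have := ltn_ord j; lia.
Qed.

Lemma coord_vec_rshift (j : 'I_n) : coord_vec R (rshift N j) = row_mx 0 (coord_vec R j).
Proof.
apply/rowP => k; rewrite /coord_vec !mxE /=.
case: splitP => l kl; rewrite !mxE //=.
  by case: eqP => // E; move: kl; rewrite E /=; have := ltn_ord l; lia.
by congr (_%:R); rewrite -!(inj_eq val_inj) /= kl eqn_add2l.
Qed.

Lemma row_mx_t (x : 'rV[R]_n) h (j : 'I_N) t :
  row_mx (h *: coord_vec R j + t) x = h *: coord_vec R (lshift n j) + row_mx t x.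
Proof. by rewrite coord_vec_lshift scale_row_mx add_row_mx scaler0 add0r. Qed.

Lemma row_mx_x (t : 'rV[R]_N) h (j : 'I_n) x :
  row_mx t (h *: coord_vec R j + x) = h *: coord_vec R (rshift N j) + row_mx t x.
Proof. by rewrite coord_vec_rshift scale_row_mx add_row_mx scaler0 add0r. Qed.

Lemma norm_row_mx (t : 'rV[R]_N) (x : 'rV[R]_n) c : `|t| < c -> `|x| < c -> `|row_mx t x| < c.
Proof.
move=> tc xc; apply: norm_lt_coord; first exact: le_lt_trans tc.
move=> i; rewrite mxE; case: splitP => j _; exact: le_lt_trans (norm_coord_le _ _) _.
Qed.

Lemma row_mx_continuous (t : 'rV[R]_N) : continuous (fun x : 'rV[R]_n => row_mx t x).
Proof.
move=> x; change (row_mx t y @[y --> x] --> row_mx t x).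
apply/(@cvgrPdist_lt _ _ _ (nbhs x) (nbhs_filter x)) => e e0; apply/nbhs_ballP; exists e => //= y.
rewrite -ball_normE /ball_/= => xy.
by rewrite opp_row_mx add_row_mx subrr; apply: norm_row_mx => //; rewrite normr0.
Qed.
End RowMx.

Lemma derivable_mx_coord m n (Z : 'rV[R]_m -> 'rV[R]_n) z v i : derivable Z z v ->
  derivable (fun z => Z z 0 i) z v /\ 'D_v Z z 0 i = 'D_v (fun z => Z z 0 i) z.
Proof.
by move=> d; split; [have /derivable_mxP := d; exact|rewrite derive_mx // mxE].
Qed.

Lemma iter_partial_coord m n (U : set 'rV[R]_m) (Z : 'rV[R]_m -> 'rV[R]_n) s z i : open U ->
  (forall s z, U z -> forall j, derivable (iter_partial s Z) z (coord_vec R j)) -> U z ->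
  iter_partial s Z z 0 i = iter_partial s (fun z => Z z 0 i) z.
Proof.
move=> Uo H; elim: s z => [//|j s IH] z Uz /=.
have [_ ->] := derivable_mx_coord i (H s z Uz j).
exact: (partial_eq Uo j (f := fun z => iter_partial s Z z 0 i)).
Qed.

(** Passes from vector-valued smoothness near 0 to scalar coordinates on a ball. The last conjunct
    is kept because [taylor_coef] uses iterated derivatives of the vector-valued W. *)
Lemma smooth_near_field m n (Z : 'rV[R]_m -> 'rV[R]_n) : smooth_near Z 0 -> exists2 r : R, 0 < r &
  smooth_field_on (@nball R m r) Z /\ forall s z i, `|z| < r ->
   iter_partial s Z z 0 i = iter_partial s (fun z => Z z 0 i) z.
Proof.
move=> [r r0 H]; exists r => //.
have Uo := @open_nball R m r.
have H1 s z : @nball R m r z -> forall j, derivable (iter_partial s Z) z (coord_vec R j).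
  by move=> Uz; have [|_] := H s z; rewrite ?subr0.
have E s z i : @nball R m r z -> iter_partial s Z z 0 i = iter_partial s (fun z => Z z 0 i) z.
  by move=> Uz; exact: (iter_partial_coord s i Uo H1).
split; last by move=> s z i zr; exact: E.
move=> i s z Uz; have [|c d] := H s z; first by rewrite subr0.
split.
  apply: (cont_eq Uo (f := fun z => iter_partial s Z z 0 i)) => //; first by move=> x Ux; rewrite E.
  apply: (@continuous_comp _ _ _ (iter_partial s Z) (fun M : 'rV[R]_n => M 0 i) z c).
  exact: coord_continuous.
move=> j; have [dj _] := derivable_mx_coord i (d j).
apply: (near_eq_derivable _ dj); apply: (near_on Uo _ Uz) => x Ux; exact: E.
Qed.

Lemma nball_le m (r1 r2 : R) : r1 <= r2 -> forall x, @nball R m r1 x -> @nball R m r2 x.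
Proof. by move=> r12 x; rewrite /nball /= => /lt_le_trans; apply. Qed.

Lemma smooth_on_subset m (U V : set 'rV[R]_m) f : (forall x, U x -> V x) -> smooth_on V f -> smooth_on U f.
Proof. by move=> UV H s z /UV; exact: H. Qed.

Lemma smooth_field_on_le m n (r1 r2 : R) (Z : 'rV[R]_m -> 'rV[R]_n) :
  r1 <= r2 -> smooth_field_on (@nball R m r2) Z -> smooth_field_on (@nball R m r1) Z.
Proof. by move=> r12 H i; exact: (smooth_on_subset (nball_le r12) (H i)). Qed.

Lemma is_derive_coord n (c : R -> 'rV[R]_n) (s : R) v i : is_derive s (1 : R) c v ->
  is_derive s (1 : R) (fun s => c s 0 i) (v 0 i).
Proof.
move=> [d E]; apply: DeriveDef; first by have /derivable_mxP := d; exact.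
by rewrite -E derive_mx // mxE.
Qed.

Lemma is_derive_mx n (c : R -> 'rV[R]_n) (s : R) (v : 'rV[R]_n) :
  (forall i, is_derive s (1 : R) (fun s => c s 0 i) (v 0 i)) -> is_derive s (1 : R) c v.
Proof.
move=> H.
have d : derivable c s 1 by apply/derivable_mxP => i j; rewrite ord1; have [] := H j.
apply: DeriveDef => //; rewrite derive_mx //; apply/rowP => j; rewrite mxE.
by have [_ ->] := H j.
Qed.

(* At the first exit time the mean value theorem would bound the displacement by [K < rho]. *)
Lemma curve_stays n (c d : R -> 'rV[R]_n) x (rho K : R) : 0 <= K < rho -> c 0 = x ->
  (forall s : R, 0 <= s <= 1 -> is_derive s (1 : R) c (d s)) ->
  (forall s : R, 0 <= s <= 1 -> `|c s - x| < rho -> `|d s| <= K) ->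
  forall s : R, 0 <= s <= 1 -> `|c s - x| < rho.
Proof.
move=> /andP[K0 Kr] c0 Hd Hb s1 s101; rewrite ltNge; apply/negP => Hs1.
pose S := [set s : R | 0 <= s <= 1 /\ rho <= `|c s - x|].
have S1 : S s1 by [].
have Slb : has_inf S by split; [exists s1|exists 0 => s [/andP[]]].
pose s0 := inf S.
have s0ge : 0 <= s0.
  by apply: lb_le_inf; [exists s1|move=> s [/andP[]]].
have s0le s : S s -> s0 <= s by move=> Ss; apply: ge_inf => //; case: Slb.
have s0le1 : s0 <= 1 by apply: le_trans (s0le _ S1) _; case/andP: s101.
have s001 : 0 <= s0 <= 1 by rewrite s0ge.
have cc s : 0 <= s <= 1 -> {for s, continuous c}.
  move=> s01; apply: differentiable_continuous; apply/derivable1_diffP.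
  by have [] := Hd s s01.
(* The infimum is itself an exit time: otherwise continuity would keep the curve inside for a while
   after s0, contradicting that exit times accumulate there. *)
have Ss0 : rho <= `|c s0 - x|.
  rewrite leNgt; apply/negP => lt0.
  have e0 : 0 < rho - `|c s0 - x| by rewrite subr_gt0.
  have /cvgrPdist_lt/(_ _ e0)/nbhs_ballP[de /= de0 Hde] := cc s0 s001.
  have [s [s01 Hs] ss] := inf_adherent de0 Slb.
  have /Hde : ball s0 de s.
    have := s0le s (conj s01 Hs).
    rewrite -ball_normE /ball_/= => h; rewrite ler0_norm; last by rewrite subr_le0.
    by rewrite opprB ltrBlDl.
  move=> h; have : `|c s - x| < rho.
    by rewrite (le_lt_trans (ler_distD (c s0) _ _)) // -ltrBrDr distrC.
  by rewrite ltNge Hs.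
have s0pos : 0 < s0.
  rewrite lt_neqAle s0ge andbT; apply/eqP => E.
  by move: Ss0; rewrite -E c0 subrr normr0 leNgt (le_lt_trans K0).
suff : `|c s0 - x| <= K by move/(le_lt_trans)/(_ Kr); rewrite ltNge Ss0.
apply: norm_le_coord => // i.
have [||xi] := @MVT R (fun s => c s 0 i) (fun s => d s 0 i) 0 s0 s0pos.
- move=> s; rewrite in_itv /= => /andP[a b]; apply: is_derive_coord; apply: Hd.
  by rewrite (ltW a) (le_trans (ltW b)).
- apply: derivable_within_continuous => s; rewrite in_itv /= => /andP[a b].
  have s01 : 0 <= s <= 1 by rewrite a (le_trans b).
  by have [] := is_derive_coord i (Hd s s01).
rewrite in_itv /= => /andP[a b] E.
have xi01 : 0 <= xi <= 1 by rewrite (ltW a) (le_trans (ltW b)).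
rewrite c0 subr0 in E; rewrite !mxE E normrM (gtr0_norm s0pos) -[leRHS]mulr1.
apply: ler_pM => //.
apply: le_trans (norm_coord_le _ _) _; apply: Hb => //.
rewrite ltNge; apply/negP => h; have := s0le xi (conj xi01 h).
by rewrite leNgt b.
Qed.
End Coordinates.

(** * Taylor expansions *)

Section Words.
Variables (R : realType) (N : nat).

(** Words of length k expand the k-th power of sum_j t_j d_j without multinomial coefficients, and
    the recursive product type matches the induction on k. *)
Fixpoint word (k : nat) : finType :=
  if k is k'.+1 then (('I_N * word k')%type : finType) else (unit : finType).

Fixpoint wseq (k : nat) : word k -> seq 'I_N :=
  match k with
  | 0 => fun _ => [::]
  | k'.+1 => fun p => p.1 :: wseq p.2
  end.

Definition content (s : seq 'I_N) : mindex N := [ffun i => count_mem i s].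

Lemma size_wseq k (w : word k) : size (wseq w) = k.
Proof. by elim: k w => [//|k IH] [i w] /=; rewrite IH. Qed.

Lemma wseq_surj (s : seq 'I_N) : exists w : word (size s), wseq w = s.
Proof.
elim: s => [|i s [w E]]; first by exists tt.
by exists (i, w); rewrite /= E.
Qed.

Lemma mi_abs_content s : mi_abs (content s) = size s.
Proof.
elim: s => [|j s IH]; first by rewrite /mi_abs big1 // => i _; rewrite ffunE.
rewrite /= -IH /mi_abs -add1n.
under eq_bigr do rewrite ffunE /=.
under [in RHS]eq_bigr do rewrite ffunE.
rewrite big_split /=; congr addn.
by rewrite (bigD1 j) //= eqxx big1 ?addn0 // => i ij; rewrite eq_sym (negbTE ij).
Qed.

Lemma tpow_content_cons (t : 'rV[R]_N) j s : tpow t (content (j :: s)) = t 0 j * tpow t (content s).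
Proof.
rewrite /tpow; under eq_bigr do rewrite ffunE /= exprD.
rewrite big_split /=; congr (_ * _).
  by rewrite (bigD1 j) //= eqxx expr1 big1 ?mulr1 // => i ij; rewrite eq_sym (negbTE ij) expr0.
by apply: eq_bigr => i _; rewrite ffunE.
Qed.

Lemma count_mi_seq (a : mindex N) i : count_mem i (mi_seq a) = a i.
Proof.
rewrite /mi_seq count_flatten -map_comp sumnE big_map big_enum /=.
rewrite (bigD1 i) //= count_nseq /= eqxx mul1n big1 ?addn0 // => j ji.
by rewrite count_nseq /= (negbTE ji) mul0n.
Qed.

Lemma content_mi_seq a : content (mi_seq a) = a.
Proof. by apply/ffunP => i; rewrite ffunE count_mi_seq. Qed.

Lemma content_perm s a : content s = a -> perm_eq s (mi_seq a).
Proof.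
by move=> <-; apply/allP => i _ /=; rewrite count_mi_seq ffunE.
Qed.
End Words.

Section TaylorW.
Variables (R : realType) (N n : nat) (rW : R) (F : 'rV[R]_(N + n) -> R).
Local Notation V := (@nball R (N + n) rW).
Local Notation Vo := (@open_nball R (N + n) rW).
Hypothesis SF : smooth_on V F.

Definition t_partial (s : seq 'I_N) : 'rV[R]_(N + n) -> R := iter_partial (map (lshift n) s) F.

Definition dir_partial (t : 'rV[R]_N) (g : 'rV[R]_(N + n) -> R) : 'rV[R]_(N + n) -> R :=
  fun w => \sum_j t 0 j * partial (lshift n j) g w.

Lemma smooth_on_dir_partial t g : smooth_on V g -> smooth_on V (dir_partial t g).
Proof.
move=> Sg.
exact: (smooth_on_sum Vo (fun j => smooth_on_scale Vo (t 0 j) (smooth_on_partial (lshift n j) Sg))).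
Qed.

Lemma iter_dir_partial k t w : V w ->
  iter k (dir_partial t) F w = \sum_(s : word N k) tpow t (content (wseq s)) * t_partial (wseq s) w.
Proof.
elim: k w => [|k IH] w Vw.
  rewrite (bigD1 tt) //= [X in _ + X]big1 ?addr0; last by case.
  by rewrite /tpow big1 ?mul1r // => i _; rewrite ffunE expr0.
rewrite /= /dir_partial -(pair_bigA _ (fun (j : 'I_N) (s : word N k) =>
   tpow t (content (j :: wseq s)) * t_partial (j :: wseq s) w)) /=.
apply: eq_bigr => j _.
rewrite (partial_eq Vo (lshift n j) IH Vw).
rewrite (partial_sum Vo (lshift n j) (fun s : word N k => smooth_on_scale Vo (tpow t (content (wseq s)))
   (smooth_on_iter (map (lshift n) (wseq s)) SF)) Vw).
rewrite mulr_sumr; apply: eq_bigr => s _.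
rewrite (partial_scale Vo _ _ (smooth_on_iter (map (lshift n) (wseq s)) SF) Vw).
by rewrite tpow_content_cons mulrA.
Qed.

Variable M : nat.

(** Taylor polynomial of F in t, of degree less than M, at (0, x). A monomial appears once for each
    ordering of its letters. *)
Definition taylorF : fam N ('rV[R]_n -> R) :=
  @Fam N _ ({k : 'I_M & word N k} : finType) (fun p => content (wseq (tagged p)))
    (fun p x => ((tag p)`!%:R)^-1 * t_partial (wseq (tagged p)) (row_mx 0 x)).

Lemma eval_family_taylorF t x : V (row_mx 0 x) ->
  eval_family taylorF t x = \sum_(k < M) (k`!%:R)^-1 * iter k (dir_partial t) F (row_mx 0 x).
Proof.
move=> Vx; rewrite /eval_family /=.
rewrite -(sig_big_dep xpredT (fun k : 'I_M => xpredT) (fun (k : 'I_M) (s : word N k) =>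
  tpow t (content (wseq s)) * ((k`!%:R)^-1 * t_partial (wseq s) (row_mx 0 x)))) /=.
apply: eq_bigr => k _; rewrite iter_dir_partial // mulr_sumr.
by apply: eq_bigr => s _; rewrite mulrCA.
Qed.

Lemma taylorF_smooth r : r <= rW -> 0 < rW -> forall p : ix taylorF, smooth_on (@nball R n r) (va p).
Proof.
move=> rrW rW0 p /=.
suff S : smooth_on (@nball R n r) (fun x => t_partial (wseq (tagged p)) (row_mx 0 x)).
  exact: (smooth_on_scale (@open_nball R n r) _ S).
apply: (@smooth_on_affine R n (N + n) (@rshift N n) (fun x => row_mx 0 x) _ V).
- by move=> h j z; exact: row_mx_x.
- exact: row_mx_continuous.
- move=> z zr; apply: norm_row_mx; first by rewrite normr0.
  exact: lt_le_trans zr rrW.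
- exact: smooth_on_iter.
Qed.

(** The bound is uniform for z near x, since it will be used at the moving point z = gam_t(x). *)
Lemma taylor_multi x : `|x| < rW -> exists2 d : R, 0 < d & exists2 C : R, 0 < C &
  forall t z, `|t| < d -> `|z - x| < d ->
  `|F (row_mx t z) - eval_family taylorF t z| <= C * `|t| ^+ M.
Proof.
move=> xW; have rW0 : 0 < rW by exact: le_lt_trans xW.
have Vx : V (row_mx 0 x) by apply: norm_row_mx; rewrite ?normr0.
have H (s : word N M) : exists rC : R * R, [/\ 0 < rC.1, 0 < rC.2 &
   forall w, `|w - row_mx 0 x| < rC.1 -> `|t_partial (wseq s) w| <= rC.2].
  have [a a0 [C C0 Hw]] := smooth_on_bounded (smooth_on_iter (map (lshift n) (wseq s)) SF) Vx.
  by exists (a, C).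
have [rC {}H] := choice H.
have [d d0 Hd] := @fin_min R (word N M) (fun i => (rC i).1) (fun i => let: And3 a _ _ := H i in a).
have [d2 d20 Hd2] := open_dist Vo Vx.
exists (Num.min d d2); first by rewrite lt_min d0.
exists (\sum_s (rC s).2 + 1).
  by rewrite ltr_wpDl // sumr_ge0 // => i _; have [_ /ltW] := H i.
move=> t z; rewrite !lt_min => /andP[td td2] /andP[zd zd2].
(* The segment from (0, z) to (t, z); differentiating F along it applies [dir_partial t]. *)
pose c (s : R) : 'rV[R]_(N + n) := s *: row_mx t 0 + row_mx 0 z.
have cE s : c s = row_mx (s *: t) z.
  by rewrite /c scale_row_mx add_row_mx scaler0 addr0 add0r.
have cdist s e : 0 <= s <= 1 -> `|t| < e -> `|z - x| < e -> `|c s - row_mx 0 x| < e.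
  move=> /andP[s0 s1] te ze; rewrite cE opp_row_mx add_row_mx oppr0 addr0.
  apply: norm_row_mx => //; rewrite normrZ ger0_norm //.
  by apply: le_lt_trans te; rewrite ler_piMl.
have cV s : 0 <= s <= 1 -> V (c s) by move=> s01; apply: Hd2; exact: cdist.
have cd (s : R) : is_derive s (1 : R) c (row_mx t 0).
  have did : derivable (id : 'rV[R]_(N + n) -> _) (c s) (row_mx t 0) by exact: derivable_id.
  have := is_derive_line did.
  by rewrite derive_id.
have SL k : smooth_on V (iter k (dir_partial t) F) by elim: k => [|k IH]; [exact: SF|exact: (smooth_on_dir_partial t IH)].
have D k (s : R) : 0 <= s <= 1 ->
    is_derive s (1 : R) (fun s => iter k (dir_partial t) F (c s)) (iter k.+1 (dir_partial t) F (c s)).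
  move=> s01; have := smooth_on_chain Vo (SL k) (cV s s01) (cd s).
  rewrite big_split_ord /= [X in _ + X]big1 ?addr0; last first.
    by move=> i _; rewrite row_mxEr mxE mul0r.
  by under eq_bigr do rewrite row_mxEl.
have B (s : R) : 0 <= s <= 1 ->
    `|iter M (dir_partial t) F (c s)| <= (\sum_s (rC s).2 + 1) * `|t| ^+ M.
  move=> s01; rewrite iter_dir_partial; last exact: cV.
  apply: (le_trans (ler_norm_sum _ _ _)).
  apply: (@le_trans _ _ (\sum_s (rC s).2 * `|t| ^+ M)); last first.
    by rewrite -mulr_suml ler_wpM2r ?exprn_ge0 // lerDl.
  apply: ler_sum => w _; rewrite normrM mulrC; have [_ _ Hi] := H w.
  apply: ler_pM => //.
    by apply: Hi; apply: cdist => //; [exact: lt_le_trans td _|exact: lt_le_trans zd _].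
  by apply: le_trans (tpow_le _ _) _; rewrite mi_abs_content size_wseq.
have i1 : (0 : R) <= (1 : R) <= (1 : R) by apply/andP; split; rewrite ?ler01 ?lexx.
have i0 : (0 : R) <= (0 : R) <= (1 : R) by apply/andP; split; rewrite ?ler01 ?lexx.
have c0 : c 0 = row_mx 0 z by rewrite cE scale0r.
have := taylor_unit D B i1; rewrite /= cE scale1r c0.
rewrite eval_family_taylorF; last by rewrite -c0; exact: cV.
by under eq_bigr do rewrite expr1n mulr1.
Qed.
End TaylorW.

(** * Expansion of functions along the flow of a polynomial family of fields *)

Section Flow.
Variables (R : realType) (N n : nat) (r : R).
Local Notation U := (@nball R n r).
Local Notation Uo := (@open_nball R n r).

Definition fieldF (F : fam N (VF R n)) (t : 'rV[R]_N) : VF R n :=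
  fun z => \sum_(i : ix F) tpow t (ex i) *: va i z.

(** With t fixed, d/ds of u along an integral curve of Y_t is Y_t u, so the Taylor coefficients at s
    = 0 are the iterates of Y_t. *)
Lemma taylor_flow (F : fam N (VF R n)) (M : nat) (u : 'rV[R]_N -> 'rV[R]_n -> R) t x c K :
  smooth_family r F -> smooth_param r u -> c 0 = x ->
  (forall s : R, 0 <= s <= 1 -> U (c s)) ->
  (forall s : R, 0 <= s <= 1 -> is_derive s (1 : R) c (fieldF F t (c s))) ->
  (forall s : R, 0 <= s <= 1 -> `|iter M (family_op r F) u t (c s)| <= K) ->
  `|u t (c 1) - \sum_(k < M) (k`!%:R)^-1 * iter k (family_op r F) u t x| <= K.
Proof.
move=> SF Su c0 cU cd cK.
have SI k : smooth_param r (iter k (family_op r F) u) by elim: k => [|k IH]; [exact: Su|exact: (smooth_param_family_op SF IH)].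
have := @taylor_unit R M (fun k s => iter k (family_op r F) u t (c s)) K _ cK 1.
rewrite c0; under eq_bigr do rewrite expr1n mulr1.
apply; last by apply/andP; split; rewrite ?ler01 ?lexx.
move=> k s s01; have Hc := smooth_on_chain Uo (SI k t) (cU s s01) (cd s s01).
apply: (is_derive_eq Hc); rewrite /= /family_op.
under eq_bigr do rewrite summxE mulr_suml.
rewrite exchange_big /=; apply: eq_bigr => i _.
rewrite lie_derivativeE; last exact: cU.
by rewrite mulr_sumr; apply: eq_bigr => j _; rewrite mxE mulrA.
Qed.

(** No monomial of the family is constant, so the field is O(|t|); this confines its integral curves
    for small t. *)
Lemma fieldF_bound (F : fam N (VF R n)) x : smooth_family r F ->
  (forall i : ix F, (0 < mi_abs (ex i))%N) -> U x ->
  exists2 d : R, 0 < d & exists2 C : R, 0 < C & forall t z, `|z - x| < d -> `|t| <= 1 ->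
  `|fieldF F t z| <= C * `|t|.
Proof.
move=> SF oF Ux.
have P1 (i : 'I_n) : has_order r 1 (fun t z => fieldF F t z 0 i).
  exists (@Fam N _ (ix F) (@ex _ _ F) (fun j z => va j z 0 i)); split=> //= [j|t z Uz].
    exact: SF.
  by rewrite /fieldF /eval_family summxE; apply: eq_bigr => j _; rewrite mxE.
have H (i : 'I_n) : exists dC : R * R, [/\ 0 < dC.1, 0 < dC.2 & forall t z,
   `|z - x| < dC.1 -> `|t| <= 1 -> `|fieldF F t z 0 i| <= dC.2 * `|t|].
  by have [d d0 [C C0 HC]] := has_order_bound (P1 i) Ux; exists (d, C).
have [dC {}H] := choice H.
have [d d0 Hd] := @fin_min R 'I_n (fun i => (dC i).1) (fun i => let: And3 a _ _ := H i in a).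
exists d => //; exists (\sum_i (dC i).2 + 1).
  by rewrite ltr_wpDl // sumr_ge0 // => i _; have [_ /ltW] := H i.
move=> t z zd t1.
have Cge : 0 <= \sum_i (dC i).2 by rewrite sumr_ge0 // => i _; have [_ /ltW] := H i.
apply: norm_le_coord => [|i]; first by rewrite mulr_ge0 // addr_ge0.
have [_ _ Hi] := H i.
apply: le_trans (Hi t z (lt_le_trans zd (Hd i)) t1) _.
rewrite ler_wpM2r // (bigD1 i) //= -addrA lerDl addr_ge0 // sumr_ge0 // => j _.
by have [_ /ltW] := H j.
Qed.

(** Two errors add up: the truncation of the exponential, small because Y^M u has order at least M,
    and the replacement of the endpoint of the flow by gam_t(x), absorbed by a Lipschitz bound for
    u. *)
Lemma expansion (F : fam N (VF R n)) (M m : nat) (u : 'rV[R]_N -> 'rV[R]_n -> R)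
    (gam : 'rV[R]_N -> 'rV[R]_n -> 'rV[R]_n) (de C0 : R) x :
  smooth_family r F -> (forall i : ix F, (0 < mi_abs (ex i))%N) -> has_order r m u -> U x ->
  (0 < M)%N -> 0 < de -> 0 < C0 -> `|x| < de ->
  (forall t z, `|t| < de -> `|z| < de -> exists y, flow1 (fieldF F t) z y /\
     `|gam t z - y| <= C0 * `|t| ^+ M) ->
  exists2 d : R, 0 < d & exists2 C : R, 0 < C & forall t, `|t| < d ->
   `|u t (gam t x) - \sum_(k < M) (k`!%:R)^-1 * iter k (family_op r F) u t x| <= C * `|t| ^+ M.
Proof.
move=> SF oF Pu Ux M0 de0 C00 xde Hflow.
have PI : has_order r M (iter M (family_op r F) u).
  suff : has_order r (M + m) (iter M (family_op r F) u) by apply: has_order_le; exact: leq_addr.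
  by elim: M {M0 Hflow} => //= k IH; rewrite -add1n -addnA; exact: has_order_family_op.
have [d0 d00 Hd0] := open_dist Uo Ux.
have [d1 d10 [C1 C10 H1]] := has_order_bound PI Ux.
have [d2 d20 [C2 C20 H2]] := has_order_Lipschitz Pu Ux.
have [d3 d30 [C3 C30 H3]] := fieldF_bound SF oF Ux.
(* [d2] is halved because gam_t(x) is reached through the endpoint y in two moves, each shorter than
   d. *)
pose d := Num.min d0 (Num.min d1 (Num.min (d2 / 2) d3)).
have dpos : 0 < d by rewrite !lt_min d00 d10 d30 divr_gt0.
have [dd0 dd1 dd2 dd3] : [/\ d <= d0, d <= d1, d <= d2 / 2 & d <= d3].
  by rewrite /d; split; rewrite !ge_min lexx ?orbT.
(* Ensures C3 |t| < d, which [curve_stays] asks for, and C0 |t|^M <= C0 |t| < d, as 0 < M and |t| <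
   1. *)
pose mu := Num.min 1 (Num.min de (Num.min (d / (C3 + 1)) (d / (C0 + 1)))).
have C3p : 0 < C3 + 1 by rewrite addr_gt0.
have C0p : 0 < C0 + 1 by rewrite addr_gt0.
exists mu; first by rewrite !lt_min ltr01 de0 !divr_gt0.
exists (C2 * C0 + C1); first by rewrite addr_gt0 // mulr_gt0.
move=> t; rewrite !lt_min => /and4P[t1 tde tC3 tC0].
have [y [[c [c0 c1 cd]] gy]] := Hflow t x tde xde.
have small (C : R) : 0 < C -> `|t| < d / (C + 1) -> C * `|t| < d.
  move=> Cp; rewrite ltr_pdivlMr ?addr_gt0 // mulrDr mulr1 mulrC => h.
  by apply: le_lt_trans h; rewrite lerDl.
have cs : forall s : R, 0 <= s <= 1 -> `|c s - x| < d.
  apply: (@curve_stays R n c (fun s => fieldF F t (c s)) x d (C3 * `|t|)) => //.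
    by rewrite mulr_ge0 ?(ltW C30) //= small.
  by move=> s s01 h; apply: H3; [exact: lt_le_trans h dd3|exact: ltW].
have T := @taylor_flow F M u t x c (C1 * `|t| ^+ M) SF (has_order_smooth Pu) c0
  (fun s s01 => Hd0 _ (lt_le_trans (cs s s01) dd0)) cd
  (fun s s01 => H1 t _ (lt_le_trans (cs s s01) dd1) (ltW t1)).
have gyd : `|gam t x - y| < d.
  apply: le_lt_trans gy _; apply: le_lt_trans (small _ C00 tC0).
  rewrite ler_wpM2l ?(ltW C00) // -[leRHS]expr1; apply: ler_wiXn2l => //; exact: ltW.
have yd : `|y - x| < d by rewrite -c1; apply: cs; rewrite ler01 lexx.
rewrite mulrDl -(subrKA (u t y)); apply: (le_trans (ler_normD _ _)); apply: lerD.
  apply: (@le_trans _ _ (C2 * `|gam t x - y|)).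
    apply: H2; last exact: ltW.
      rewrite -(subrKA y) (le_lt_trans (ler_normD _ _)) //.
      by have := ltrD gyd yd; lra.
    by lra.
  by rewrite -mulrA ler_wpM2l // ltW.
by rewrite -c1.
Qed.
End Flow.

(** * The logarithmic derivative of the exponential *)

Section PolyAux.
Variable R : realType.

Lemma poly_fun_inj (p q : {poly R}) : (forall e, p.[e] = q.[e]) -> p = q.
Proof.
move=> H; apply/eqP; rewrite -subr_eq0; apply/eqP/polyP => k; rewrite coef0.
apply: (@poly_small R k.+1 _ 0) => // d d0; exists (d / 2).
  by apply/andP; split; lra.
by rewrite hornerD hornerN H subrr normr0 mul0r.
Qed.

Lemma sum_shift (T : zmodType) (M q : nat) (g : nat -> T) :
  \sum_(k < M | (q < k)%N) g (k - q.+1)%N = \sum_(j < M | (j + q.+1 < M)%N) g j.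
Proof.
have [Mq|qM] := leqP M q.
  by rewrite !big_pred0 // => k; apply/negbTE; have := ltn_ord k; lia.
have -> : \sum_(j < M | (j + q.+1 < M)%N) g j = \sum_(j < M - q.+1) g j.
  rewrite (big_ord_widen M) ?leq_subr //.
  by apply: eq_bigl => j; rewrite addnC -ltn_subRL.
rewrite -(big_mkord (fun k => (q < k)%N) (fun k => g (k - q.+1)%N)).
rewrite (@big_cat_nat _ _ _ q.+1) //= big_nat_cond big_pred0 ?add0r; last first.
  by move=> k; apply/negbTE; lia.
rewrite -{1}[q.+1]add0n big_addn big_nat_cond -(big_mkord xpredT g) [RHS]big_nat_cond.
apply: eq_big => [k|k _]; first by rewrite andbT; lia.
by rewrite addnK.
Qed.
End PolyAux.

(** * From vanishing along rays to order in t, and inversion of the exponential *)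

Section Flat.
Variables (R : realType) (N n : nat) (r : R).
Local Notation U := (@nball R n r).
Local Notation Uo := (@open_nball R n r).
Local Notation fun2 := ('rV[R]_N -> 'rV[R]_n -> R).

(** Order m seen on each ray separately. It is all that the one-variable estimates yield, and by
    itself it exhibits no family of monomials. *)
Definition flat m (g : fun2) := forall t x, U x -> exists p : {poly R},
  (forall e, g (e *: t) x = p.[e]) /\ forall k, (k < m)%N -> p`_k = 0.

Lemma has_order_flat m g : has_order r m g -> flat m g.
Proof. by move=> Pg t x Ux; exact: (has_order_poly t Pg Ux). Qed.

Lemma flat_add m g h : flat m g -> flat m h -> flat m (g + h).
Proof.
move=> Fg Fh t x Ux; have [p [Ep Hp]] := Fg t x Ux; have [q [Eq Hq]] := Fh t x Ux.
exists (p + q); split=> [e|k km]; last by rewrite coefD Hp // Hq // addr0.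
by rewrite hornerD -Ep -Eq.
Qed.

Lemma flat_le m1 m2 g : (m1 <= m2)%N -> flat m2 g -> flat m1 g.
Proof.
move=> m12 Fg t x Ux; have [p [Ep Hp]] := Fg t x Ux; exists p; split=> // k km.
by apply: Hp; exact: leq_trans m12.
Qed.

Variable F : fam N (VF R n).
Hypothesis SF : smooth_family r F.
Hypothesis oF : forall i : ix F, (0 < mi_abs (ex i))%N.
Local Notation Y := (family_op r F).

Lemma smooth_param_iterY k u : smooth_param r u -> smooth_param r (iter k Y u).
Proof. by move=> Su; elim: k => [|k IH]; [exact: Su|exact: (smooth_param_family_op SF IH)]. Qed.

Lemma iterY_add k u v : smooth_param r u -> smooth_param r v -> iter k Y (u + v) = iter k Y u + iter k Y v.
Proof.
move=> Su Sv; elim: k => // k IH.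
by rewrite !iterS IH (family_op_add F (smooth_param_iterY k Su) (smooth_param_iterY k Sv)).
Qed.

Lemma iterY_scale k c u : smooth_param r u -> iter k Y (c *: u) = c *: iter k Y u.
Proof.
move=> Su; elim: k => // k IH.
by rewrite !iterS IH (family_op_scale F c (smooth_param_iterY k Su)).
Qed.

Lemma iterY_sum k (I : Type) (s : seq I) (G : I -> fun2) : (forall i, smooth_param r (G i)) ->
  iter k Y (\sum_(i <- s) G i) = \sum_(i <- s) iter k Y (G i).
Proof.
move=> SG; elim: s => [|i s IH].
  rewrite !big_nil -[X in iter k Y X](scale0r (0 : fun2)) iterY_scale ?scale0r //.
  exact: smooth_param_0.
rewrite !big_cons iterY_add ?IH //.
elim: s {IH} => [|j s IH]; first by rewrite big_nil; exact: smooth_param_0.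
by rewrite big_cons; exact: (smooth_param_add (SG j) IH).
Qed.

Lemma has_order_iterY k m u : has_order r m u -> has_order r (k + m) (iter k Y u).
Proof.
by move=> Pu; elim: k => // k IH; rewrite addSn -add1n; exact: (has_order_family_op SF).
Qed.

(** On a ray, the monomials of degree m add up to the coefficient of X^m, which flatness makes zero.
    They can be deleted from the representation without changing G. *)
Lemma has_order_flatS m G : has_order r m G -> flat m.+1 G -> has_order r m.+1 G.
Proof.
move=> [H [SH oH EH]] FG.
pose A : {pred ix H} := [pred i | mi_abs (ex i) != m].
exists (@Fam N _ ({i in A} : finType) (fun i => ex (val i)) (fun i => va (val i))); split=> /=.
- by move=> i; exact: SH.
- by move=> [i /= Ai]; move: (Ai); rewrite inE => im; rewrite ltn_neqAle eq_sym im oH.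
move=> t x Ux; rewrite EH //.
rewrite /eval_family (bigID A) /= [X in _ + X = _](_ : _ = 0).
  by rewrite addr0 -(big_sub A (fun i => tpow t (ex i) * va i x)).
have [p [Ep Hp]] := FG t x Ux.
have pE : p = \sum_(i : ix H) (tpow t (ex i) * va i x) *: 'X^(mi_abs (ex i)).
  apply: poly_fun_inj => e; rewrite -Ep EH // horner_sum; apply: eq_bigr => i _.
  by rewrite hornerZ hornerXn tpow_scale -mulrA mulrC.
rewrite -[RHS](Hp m (ltnSn m)) pE coef_sum [LHS]big_mkcond; apply: eq_bigr => i _.
rewrite coefZ coefXn /A /= negbK [m == _]eq_sym.
by case: eqP; rewrite ?mulr1 ?mulr0.
Qed.

(** exp Y is the identity plus terms raising the order. If G has order m, those terms have order m +
    1, so flatness of the whole sum passes to G, which then has order m + 1. *)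
Lemma exp_inj M G : has_order r 0 G -> flat M (\sum_(k < M) (k`!%:R^-1 : R) *: iter k Y G) ->
  has_order r M G.
Proof.
move=> P0 FS; suff : forall m, (m <= M)%N -> has_order r m G by apply.
elim=> [//|m IH] mM; have {}IH := IH (ltnW mM).
apply: has_order_flatS => //.
case: M mM FS {P0} => // M mM FS.
rewrite big_ord_recl /= fact0 invr1 scale1r in FS.
set rest := \sum_(i < M) _ in FS.
have Prest : has_order r m.+1 rest.
  apply: has_order_sum => k _; apply: has_order_scale.
  apply: (@has_order_le _ _ _ _ _ (k.+1 + m)%N); first by rewrite addSn ltnS leq_addl.
  exact: (@has_order_iterY k.+1).
have -> : G = (G + rest) + (-1) *: rest by rewrite scaleN1r addrK.
apply: flat_add; first exact: flat_le FS.
by apply: has_order_flat; exact: has_order_scale.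
Qed.

Fixpoint ad_family (q : nat) : fam N (VF R n) :=
  if q is q'.+1 then lieF (ad_family q') F else eulerF F.

Lemma smooth_family_ad_family q : smooth_family r (ad_family q).
Proof.
by elim: q => [|q IH]; [exact: (smooth_family_eulerF SF)|exact: (smooth_family_lieF IH SF)].
Qed.

(** E Y has no constant monomial, and each bracket with Y adds at least one to the degree; this
    justifies truncating at q < M. *)
Lemma order_ad_family q (j : ix (ad_family q)) : (q.+1 <= mi_abs (ex j))%N.
Proof.
elim: q j => [|q IH]; first exact: oF.
by move=> [j i] /=; rewrite mi_abs_madd -addn1 leq_add // oF.
Qed.

Local Notation B := (fun q => family_op r (ad_family q)).

Lemma iterY_euler_pair k u : smooth_param r u -> euler_pair r u 0 -> euler_pair r (iter k Y u) (expB Y B k u).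
Proof.
move=> Su E0; elim: k => [|k IH]; first by rewrite /expB big_ord0.
have E : Y (expB Y B k u) + family_op r (eulerF F) (iter k Y u) = expB Y B k.+1 u.
  apply: (@expB_S _ (@smooth_param R n r N) Y B); last exact: Su.
  - exact: smooth_param_0.
  - by move=> v w Sv Sw; exact: (smooth_param_add Sv Sw).
  - by move=> v Sv; exact: (smooth_param_family_op SF Sv).
  - by move=> q v Sv; exact: (smooth_param_family_op (@smooth_family_ad_family q) Sv).
  - by move=> v w Sv Sw; exact: (family_op_add F Sv Sw).
  - by move=> q v Sv; exact: (family_op_comm (@smooth_family_ad_family q) SF Sv).
by rewrite -E; exact: (euler_pair_family_op SF IH).
Qed.

Definition logd M (u : fun2) : fun2 := \sum_(q < M) (q.+1`!%:R^-1 : R) *: family_op r (ad_family q) u.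

(** Truncated form of E (exp Y) u = exp Y (logd u) when E u = 0. Both double sums consist of the
    terms [G j q]; they differ only in those with j + q + 1 >= M, which have order at least M. *)
Lemma exp_logd M u : has_order r 0 u ->
  has_order r M (\sum_(k < M) (k`!%:R^-1 : R) *: iter k Y (logd M u)
           - \sum_(k < M) (k`!%:R^-1 : R) *: expB Y B k u).
Proof.
move=> Pu; have Su := has_order_smooth Pu.
pose G j q : fun2 := (j`!%:R^-1 * q.+1`!%:R^-1 : R) *: iter j Y (family_op r (ad_family q) u).
have SB q : smooth_param r (family_op r (ad_family q) u) by exact: (smooth_param_family_op (@smooth_family_ad_family q) Su).
have PG j q : has_order r (j + q.+1) (G j q).
  apply: has_order_scale; apply: has_order_iterY; rewrite -[q.+1]addn0.
  by apply: (has_order_family_op (@smooth_family_ad_family q)) => // i; exact: order_ad_family.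
have -> : \sum_(k < M) (k`!%:R^-1 : R) *: iter k Y (logd M u) =
    \sum_(q < M) \sum_(j < M) G j q.
  rewrite exchange_big /=; apply: eq_bigr => k _.
  rewrite /logd iterY_sum; last by move=> q; exact: (smooth_param_scale _ (SB q)).
  rewrite scaler_sumr; apply: eq_bigr => q _.
  by rewrite (iterY_scale _ _ (SB q)) scalerA.
have -> : \sum_(k < M) (k`!%:R^-1 : R) *: expB Y B k u =
    \sum_(q < M) \sum_(j < M | (j + q.+1 < M)%N) G j q.
  transitivity (\sum_(k < M) \sum_(q < M | (q < k)%N) G (k - q.+1)%N q).
    apply: eq_bigr => k _; rewrite /expB scaler_sumr.
    rewrite (big_ord_widen M (fun q => (k`!%:R^-1 : R) *: (iter (k - q.+1) Y (family_op r (ad_family q) u) *+ 'C(k, q.+1)))) ?(ltnW (ltn_ord k)) //.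
    apply: eq_bigr => q qk; rewrite /G -[X in _ *: X = _]scaler_nat scalerA; congr (_ *: _).
    (* C(k, q+1) / k! = 1 / ((q+1)! (k-q-1)!), which separates the two exponential-type series. *)
    rewrite -(bin_fact qk) natrM [(q.+1`! * _)%:R]natrM.
    have f1 : (q.+1`!%:R : R) != 0 by rewrite pnatr_eq0 -lt0n fact_gt0.
    have f2 : ((k - q.+1)`!%:R : R) != 0 by rewrite pnatr_eq0 -lt0n fact_gt0.
    have f3 : ('C(k, q.+1)%:R : R) != 0 by rewrite pnatr_eq0 -lt0n bin_gt0.
    move: f1 f2 f3; move: (q.+1`!%:R : R) ((k - q.+1)`!%:R : R) ('C(k, q.+1)%:R : R).
    by move=> a b c a0 b0 c0; field; rewrite a0 b0 c0.
  rewrite (exchange_big_dep xpredT) //=; apply: eq_bigr => q _.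
  exact: (sum_shift M q (fun j => G j q)).
rewrite -sumrB; apply: has_order_sum => q _.
rewrite [X in X - _](bigID (fun j : 'I_M => (j + q.+1 < M)%N)) /= addrAC subrr add0r.
by apply: has_order_sum => j jq; apply: has_order_le (PG j q); rewrite leqNgt.
Qed.
End Flat.

(** * Comparison with the Taylor coefficients of W *)

Section Key.
Variables (R : realType) (N n : nat).
Variables (gam W : 'rV[R]_N -> 'rV[R]_n -> 'rV[R]_n) (Xh : mindex N -> VF R n).
Variables (M : nat) (r C0 : R).

Definition boxA : {pred {ffun 'I_N -> 'I_M}} := [pred b | (0 < mi_abs (fmi b) < M)%N].

Definition exp_family : fam N (VF R n) :=
  @Fam N _ ({b in boxA} : finType) (fun b => fmi (val b)) (fun b => Xh (fmi (val b))).

Lemma fieldF_exp_family t : fieldF exp_family t =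
  (fun z => \sum_(b : {ffun 'I_N -> 'I_M} | (0 < mi_abs (fmi b) < M)%N)
     tpow t (fmi b) *: Xh (fmi b) z).
Proof.
apply/funext => z; rewrite /fieldF /=.
by rewrite -(big_sub boxA (fun b => tpow t (fmi b) *: Xh (fmi b) z)).
Qed.

Lemma order_exp_family (i : ix exp_family) : (0 < mi_abs (ex i))%N.
Proof. by case: i => b /= Ab; move: (Ab); rewrite inE => /andP[]. Qed.

Hypothesis r0 : 0 < r.
Hypothesis C00 : 0 < C0.
Hypothesis M0 : (0 < M)%N.
Hypothesis SX : smooth_family r exp_family.
Hypothesis SW : smooth_field_on (@nball R (N + n) r) (unc W).
Hypothesis Sg : smooth_field_on (@nball R (N + n) r) (unc gam).
Hypothesis gam0 : forall x, `|x| < r -> gam 0 x = x.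
Hypothesis hW : forall t y, `|t| < r -> `|y| < r ->
  W t (gam t y) = derive (fun eps : R => gam (eps *: t) y) 1 1.
Hypothesis hflow : forall t z, `|t| < r -> `|z| < r -> exists y,
  flow1 (fieldF exp_family t) z y /\ `|gam t z - y| <= C0 * `|t| ^+ M.

Local Notation U := (@nball R n r).
Local Notation Uo := (@open_nball R n r).
Local Notation V := (@nball R (N + n) r).
Local Notation Vo := (@open_nball R (N + n) r).
Local Notation Y := (family_op r exp_family).
Local Notation B := (fun q => family_op r (ad_family exp_family q)).

(** Keeps gam_t(x) in the neighbourhood of x where the Taylor bound for W holds. *)
Lemma gam_close x d : U x -> 0 < d ->
  exists2 d' : R, 0 < d' & forall t, `|t| < d' -> `|gam t x - x| < d.
Proof.
move=> Ux d0.
have Vx : V (row_mx 0 x) by apply: norm_row_mx; rewrite ?normr0.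
have H (i : 'I_n) : exists d' : R, 0 < d' /\
    forall w, `|w - row_mx 0 x| < d' -> `|unc gam w 0 i - unc gam (row_mx 0 x) 0 i| < d.
  by have [d' d'0 Hd'] := cont_dist d0 (smooth_on_content (Sg i) Vx); exists d'.
have [dd {}H] := choice H.
have [d' d'0 Hd'] := @fin_min R 'I_n dd (fun i => (H i).1).
exists d' => // t td; apply: norm_lt_coord => // i.
have := (H i).2 (row_mx t x); rewrite opp_row_mx add_row_mx subrr oppr0 addr0.
rewrite /unc !row_mxKl !row_mxKr gam0 // !mxE; apply.
by apply: norm_row_mx; rewrite ?normr0; [exact: lt_le_trans td _|exact: lt_le_trans d'0 _].
Qed.

Lemma gam_ray (t : 'rV[R]_N) x (e : R) i : U x -> `|e *: t| < r ->
  is_derive e (1 : R) (fun e : R => gam (e *: t) x 0 i)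
   (\sum_j t 0 j * partial (lshift n j) (fun w => unc gam w 0 i) (row_mx (e *: t) x)).
Proof.
move=> Ux et.
pose c (s : R) : 'rV[R]_(N + n) := s *: row_mx t 0 + row_mx 0 x.
have cE s : c s = row_mx (s *: t) x.
  by rewrite /c scale_row_mx add_row_mx scaler0 addr0 add0r.
have cd (s : R) : is_derive s (1 : R) c (row_mx t 0).
  have did : derivable (id : 'rV[R]_(N + n) -> _) (c s) (row_mx t 0) by exact: derivable_id.
  have := is_derive_line did.
  by rewrite derive_id.
have Vc : V (c e) by rewrite cE; exact: norm_row_mx.
have := smooth_on_chain Vo (Sg i) Vc (cd e).
rewrite big_split_ord /= [X in _ + X]big1 ?addr0; last first.
  by move=> j _; rewrite row_mxEr mxE mul0r.
under eq_bigr do rewrite row_mxEl.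
rewrite cE.
have -> // : (fun s => unc gam (c s) 0 i) = (fun e : R => gam (e *: t) x 0 i).
by apply/funext => s; rewrite cE /unc row_mxKl row_mxKr.
Qed.

(** The defining relation of W at the parameter e t: the derivative in eps at 1 along e t is e times
    the derivative along t. *)
Lemma W_ray (t : 'rV[R]_N) x (e : R) i : U x -> `|e *: t| < r ->
  e * (\sum_j t 0 j * partial (lshift n j) (fun w => unc gam w 0 i) (row_mx (e *: t) x)) =
  W (e *: t) (gam (e *: t) x) 0 i.
Proof.
move=> Ux et; rewrite hW //.
have et1 : `|1 *: (e *: t)| < r by rewrite scale1r.
have D : is_derive (1 : R) (1 : R) (fun eps : R => gam (eps *: (e *: t)) x)
    (\row_i \sum_j (e *: t) 0 j * partial (lshift n j) (fun w => unc gam w 0 i) (row_mx (1 *: (e *: t)) x)).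
  by apply: is_derive_mx => k; rewrite mxE; exact: gam_ray.
have [_ ->] := D; rewrite mxE mulr_sumr; apply: eq_bigr => j _.
by rewrite scale1r mxE mulrA.
Qed.

Definition W_coord i : 'rV[R]_(N + n) -> R := fun w => unc W w 0 i.
Definition taylorW i : 'rV[R]_N -> 'rV[R]_n -> R := eval_family (taylorF (W_coord i) M).
Definition coord_fun (i : 'I_n) : 'rV[R]_N -> 'rV[R]_n -> R := fun _ x => x 0 i.

Lemma has_order_taylorW i : has_order r 0 (taylorW i).
Proof.
exists (taylorF (W_coord i) M); split=> // p.
exact: (taylorF_smooth (SW i) (lexx r) r0 p).
Qed.

Lemma has_order_coord_fun i : has_order r 0 (coord_fun i).
Proof.
exists (@Fam N _ (unit : finType) (fun=> [ffun=> 0%N]) (fun=> fun x : 'rV[R]_n => x 0 i)); split=> /= [j|//|t x Ux].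
  exact: (smooth_on_coord Uo i).
rewrite /eval_family /= (bigD1 tt) //= [X in _ + X]big1 ?addr0; last by case.
by rewrite /tpow big1 ?mul1r // => j _; rewrite ffunE expr0.
Qed.

Lemma euler_pair_coord_fun i : euler_pair r (coord_fun i) 0.
Proof. exact: (euler_pair_cst N (smooth_on_coord Uo i)). Qed.

Lemma sum2E (T1 T2 : Type) (c : 'I_M -> R) (u : 'I_M -> T1 -> T2 -> R) t x :
  (\sum_(k < M) c k *: u k) t x = \sum_(k < M) c k * u k t x.
Proof. by rewrite !fct_sumE. Qed.

(** The analytic heart. On a ray, p expands the i-th coordinate of gam and q expands that of W along
    gam, which is e d/de of the former; [euler_poly] then compares q with X p'. *)
Lemma main_flat i : flat r M (\sum_(k < M) (k`!%:R^-1 : R) *: iter k Y (taylorW i)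
   - \sum_(k < M) (k`!%:R^-1 : R) *: expB Y B k (coord_fun i)).
Proof.
move=> t x Ux.
set w := \sum_(k < M) _ *: iter k Y (taylorW i).
set v := \sum_(k < M) _ *: expB Y B k (coord_fun i).
pose u := \sum_(k < M) (k`!%:R^-1 : R) *: iter k Y (coord_fun i).
have Euv : euler_pair r u v.
  apply: euler_pair_sum => k; apply: euler_pair_scale.
  exact: (iterY_euler_pair SX _ (has_order_smooth (has_order_coord_fun i)) (euler_pair_coord_fun i)).
have Pw : has_order r 0 w.
  apply: has_order_sum => k _; apply: has_order_scale; apply: (@has_order_le _ _ _ _ _ (k + 0)) => //.
  exact: (has_order_iterY SX order_exp_family k (has_order_taylorW i)).
have [p Ep] := euler_pair_poly t Euv Ux.
have [q [Eq _]] := has_order_poly t Pw Ux.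
exists (q - 'X * p^`()); split.
  move=> e; rewrite hornerD hornerN -(Eq e) -(Ep e).2.
  by [].
have [d1 d10 [C1 C10 H1]] := expansion SX order_exp_family (has_order_coord_fun i) Ux M0 r0 C00 Ux hflow.
have [d2 d20 [C2 C20 H2]] := expansion SX order_exp_family (has_order_taylorW i) Ux M0 r0 C00 Ux hflow.
have [d3 d30 [C3 C30 H3]] := taylor_multi (SW i) M Ux.
have [d4 d40 H4] := gam_close Ux d30.
pose mn := Num.min r (Num.min d1 (Num.min d2 (Num.min d3 d4))).
have mn0 : 0 < mn by rewrite !lt_min r0 d10 d20 d30 d40.
have t1 : 0 < `|t| + 1 by rewrite ltr_wpDl.
(* Dividing by |t| + 1 and not by |t| covers t = 0. *)
have Hmn e : 0 < e < mn / (`|t| + 1) -> [/\ `|e *: t| < r, `|e *: t| < d1, `|e *: t| < d2,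
     `|e *: t| < d3 & `|e *: t| < d4].
  move=> /andP[e0]; rewrite ltr_pdivlMr // => he.
  have : `|e *: t| < mn.
    by rewrite normrZ gtr0_norm //; apply: le_lt_trans he; rewrite ler_wpM2l ?(ltW e0) // lerDl.
  by rewrite !lt_min => /and5P[].
have nX e : 0 < e -> `|e *: t| ^+ M = `|t| ^+ M * e ^+ M.
  by move=> e0; rewrite normrZ gtr0_norm // exprMn mulrC.
have tM : 0 <= `|t| ^+ M by rewrite exprn_ge0.
(* C1 is the error on the coordinate of gam. The error on W is C2 + C3: its Taylor polynomial is
   expanded along gam, and W is replaced by that polynomial at gam_t(x). *)
apply: (@euler_poly R (fun e => gam (e *: t) x 0 i)
  (fun e => \sum_j t 0 j * partial (lshift n j) (fun w => unc gam w 0 i) (row_mx (e *: t) x))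
  p q M ((C1 + (C2 + C3)) * `|t| ^+ M) (mn / (`|t| + 1))).
- by rewrite divr_gt0.
- by move=> e /Hmn[er _ _ _ _]; exact: gam_ray.
- move=> e he; have [er ed1 _ _ _] := Hmn e he; have e0 : 0 < e by case/andP: he.
  have := H1 _ ed1; rewrite -(Ep e).1 /u sum2E => h; apply: (le_trans h).
  rewrite nX // mulrA ler_wpM2r ?exprn_ge0 ?(ltW e0) // ler_wpM2r //.
  by rewrite lerDl addr_ge0 // ltW.
- move=> e he; have [er _ ed2 ed3 ed4] := Hmn e he; have e0 : 0 < e by case/andP: he.
  rewrite W_ray // -(Eq e) /w sum2E.
  have h2 := H2 _ ed2.
  have := H3 (e *: t) (gam (e *: t) x) ed3 (H4 _ ed4).
  rewrite /W_coord /unc row_mxKl row_mxKr => h3.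
  rewrite -(subrKA (taylorW i (e *: t) (gam (e *: t) x))).
  apply: (le_trans (ler_normD _ _)); apply: (le_trans (lerD h3 h2)).
  rewrite -mulrDl nX // mulrA ler_wpM2r ?exprn_ge0 ?(ltW e0) // ler_wpM2r //.
  by rewrite [C3 + C2]addrC lerDr ltW.
Qed.

(** exp Y applied to the difference is flat, by [main_flat] and [exp_logd], and [exp_inj] removes
    the exponential. *)
Lemma has_order_main i : has_order r M (taylorW i - logd r exp_family M (coord_fun i)).
Proof.
have Pcf := has_order_coord_fun i; have Scf := has_order_smooth Pcf; have SPW := has_order_smooth (has_order_taylorW i).
have PL : has_order r 0 (logd r exp_family M (coord_fun i)).
  apply: has_order_sum => q _; apply: has_order_scale.
  apply: (@has_order_le _ _ _ _ _ (0 + 0)) => //.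
  exact: (has_order_family_op (@smooth_family_ad_family _ _ _ _ _ SX q)).
have SL := has_order_smooth PL.
have -> : taylorW i - logd r exp_family M (coord_fun i) = taylorW i + (-1) *: logd r exp_family M (coord_fun i).
  by rewrite scaleN1r.
apply: (exp_inj SX order_exp_family).
  by apply: has_order_add; [exact: has_order_taylorW|exact: has_order_scale].
have E : \sum_(k < M) (k`!%:R^-1 : R) *: iter k Y (taylorW i + (-1) *: logd r exp_family M (coord_fun i)) =
   (\sum_(k < M) (k`!%:R^-1 : R) *: iter k Y (taylorW i)
     - \sum_(k < M) (k`!%:R^-1 : R) *: expB Y B k (coord_fun i)) +
   (-1) *: (\sum_(k < M) (k`!%:R^-1 : R) *: iter k Y (logd r exp_family M (coord_fun i))
           - \sum_(k < M) (k`!%:R^-1 : R) *: expB Y B k (coord_fun i)).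
  rewrite [in RHS]scaleN1r [in RHS]opprB addrA subrK -sumrB; apply: eq_bigr => k _.
  rewrite (iterY_add SX k SPW (smooth_param_scale (-1) SL)) (iterY_scale SX k (-1) SL).
  by rewrite scaleN1r scalerBr.
rewrite E; apply: flat_add; first exact: main_flat.
by apply: has_order_flat; apply: has_order_scale; exact: (exp_logd SX order_exp_family M Pcf).
Qed.

Lemma family_op_coord_fun (F : fam N (VF R n)) i t x : U x ->
  family_op r F (coord_fun i) t x = \sum_(j : ix F) tpow t (ex j) * va j x 0 i.
Proof.
move=> Ux; apply: eq_bigr => j _; congr (_ * _); rewrite lie_derivativeE // (bigD1 i) //=.
rewrite partial_coord eqxx mulr1 big1 ?addr0 // => k ki.
by rewrite partial_coord eq_sym (negbTE ki) mulr0.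
Qed.

(** The Taylor terms, the bracket terms and the remainder form a single polynomial vanishing for all
    t, to which [tpow_coef] applies. The remainder contributes nothing, its monomials having degree
    at least M. *)
Lemma coef_coord i alpha x : U x -> (mi_abs alpha < M)%N ->
  \sum_(p : ix (taylorF (W_coord i) M) | ex p == alpha) va p x =
  \sum_(q < M) (q.+1`!%:R^-1 : R) * \sum_(j : ix (ad_family exp_family q) | ex j == alpha) va j x 0 i.
Proof.
move=> Ux aM; have [H [_ oH EH]] := has_order_main i.
pose S := ({q : 'I_M & ix (ad_family exp_family q)} : finType).
pose I := (ix (taylorF (W_coord i) M) + (S + ix H))%type.
pose a (s : I) := match s with inl p => ex p | inr (inl p) => ex (tagged p) | inr (inr h) => ex h end.
pose c (s : I) : R := match s with
  | inl p => va p x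
  | inr (inl p) => - ((tag p).+1`!%:R^-1 * va (tagged p) x 0 i)
  | inr (inr h) => - va h x end.
have Z (t : 'rV[R]_N) : \sum_s tpow t (a s) * c s = 0.
  rewrite !big_sumType /= addrA.
  have -> : \sum_(h : ix H) tpow t (ex h) * - va h x = - eval_family H t x.
    by rewrite -sumrN; apply: eq_bigr => h _; rewrite mulrN.
  rewrite -EH // -[(_ - _) t x]/(taylorW i t x - logd r exp_family M (coord_fun i) t x).
  have -> : \sum_(p : S) tpow t (ex (tagged p)) * - ((tag p).+1`!%:R^-1 * va (tagged p) x 0 i) =
    - logd r exp_family M (coord_fun i) t x.
    rewrite /logd sum2E -sumrN.
    rewrite -(sig_big_dep xpredT (fun k : 'I_M => xpredT) (fun (q : 'I_M) (j : ix (ad_family exp_family q)) =>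
      tpow t (ex j) * - (q.+1`!%:R^-1 * va j x 0 i))) /=.
    apply: eq_bigr => q _; rewrite family_op_coord_fun // mulr_sumr -sumrN; apply: eq_bigr => j _.
    by rewrite mulrN mulrCA.
  by rewrite subrr.
have := tpow_coef Z alpha; rewrite !big_sumType /=.
rewrite [X in _ + (_ + X)]big_pred0 ?addr0; last first.
  by move=> h; apply/negbTE/eqP => E; have := oH h; rewrite E leqNgt aM.
rewrite -(sig_big_dep xpredT (fun (q : 'I_M) (j : ix (ad_family exp_family q)) => ex j == alpha)
  (fun (q : 'I_M) (j : ix (ad_family exp_family q)) => - (q.+1`!%:R^-1 * va j x 0 i))) /=.
move/eqP; rewrite addr_eq0 => /eqP ->; rewrite -sumrN; apply: eq_bigr => q _.
by rewrite sumrN opprK mulr_sumr.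
Qed.

Hypothesis hWc : forall s z i, `|z| < r ->
  iter_partial s (unc W) z 0 i = iter_partial s (W_coord i) z.

Lemma taylor_coef_coord alpha x i : U x ->
  taylor_coef W alpha x 0 i =
  (mi_fact alpha)%:R^-1 * t_partial (W_coord i) (mi_seq alpha) (row_mx 0 x).
Proof.
move=> Ux; rewrite mxE; congr (_ * _).
have -> : (fun t => W t x) = (fun t => unc W (row_mx t x)).
  by apply/funext => t; rewrite /unc row_mxKl row_mxKr.
rewrite (@iter_partial_affine R _ N (N + n) (@lshift N n) (fun t => row_mx t x)); last first.
  by move=> h j t; exact: row_mx_t.
by rewrite hWc //; apply: norm_row_mx; rewrite ?normr0.
Qed.

Lemma mi_fact_gt0 (alpha : mindex N) : (0 < mi_fact alpha)%N.
Proof. by rewrite /mi_fact prodn_gt0 // => i; exact: fact_gt0. Qed.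

(** By symmetry of derivatives, all words with content [alpha] give the same Taylor term, so these
    terms add up to a multiple of the Taylor coefficient. The multiple is in fact 1; its positivity
    suffices, and this avoids counting words. *)
Lemma key_relation alpha : (mi_abs alpha < M)%N -> exists2 c : R, 0 < c &
  forall x, U x -> c *: taylor_coef W alpha x =
   \sum_(q < M) (q.+1`!%:R^-1 : R) *: \sum_(j : ix (ad_family exp_family q) | ex j == alpha) va j x.
Proof.
move=> aM.
pose S := ({k : 'I_M & word N k} : finType).
pose c := \sum_(p : S | content (wseq (tagged p)) == alpha) ((tag p)`!%:R^-1 : R).
have c0 : 0 < c.
  have [w wE] := wseq_surj (mi_seq alpha).
  have sz : (size (mi_seq alpha) < M)%N by rewrite -mi_abs_content content_mi_seq.
  (* The word [mi_seq alpha] itself shows that the sum defining c is not empty. *)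
  pose p : S := Tagged (fun k : 'I_M => word N k) (w : word N (Ordinal sz)).
  rewrite /c (bigD1 p) /=; last by rewrite wE content_mi_seq.
  rewrite ltr_wpDr ?invr_gt0 ?ltr0n ?fact_gt0 //.
  by apply: sumr_ge0 => k _; rewrite invr_ge0 ler0n.
exists (c * (mi_fact alpha)%:R); first by rewrite mulr_gt0 // ltr0n mi_fact_gt0.
move=> x Ux; apply/rowP => i.
rewrite mxE taylor_coef_coord // mulrA mulfK; last by rewrite pnatr_eq0 -lt0n mi_fact_gt0.
rewrite summxE.
transitivity (\sum_(p : ix (taylorF (W_coord i) M) | ex p == alpha) va p x).
  rewrite /c mulr_suml; apply: eq_bigr => p /eqP pa /=; congr (_ * _).
  apply/esym/(iter_partial_perm Vo (SW i)).
    by apply: norm_row_mx; rewrite ?normr0.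
  by apply: perm_map; exact: content_perm.
rewrite coef_coord //; apply: eq_bigr => q _.
by rewrite mxE summxE.
Qed.
End Key.

(** * Spans of iterated brackets *)

Section Spans.
Variables (R : realType) (N n : nat).
Implicit Types (X : mindex N -> VF R n) (S : mindex N -> Prop).

(** Brackets labelled by the sum of the multi-indices of their entries, all taken in S. With S
    everything this gives the algebra of the union, with S the pure indices that of the pure
    part. *)
Inductive graded_bracket X S : VF R n -> mindex N -> Prop :=
| graded_bracket_base a : (0 < mi_abs a)%N -> S a -> graded_bracket X S (X a) a
| graded_bracket_br Z1 a1 Z2 a2 : graded_bracket X S Z1 a1 -> graded_bracket X S Z2 a2 -> graded_bracket X S (lie Z1 Z2) (madd a1 a2).

Definition graded_span X S (Z : VF R n) (a : mindex N) :=
  exists (k : nat) (c : 'I_k -> R) (Zs : 'I_k -> VF R n), (forall j, graded_bracket X S (Zs j) a) /\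
    \forall x \near (0 : 'rV[R]_n), Z x = \sum_j c j *: Zs j x.

Definition smooth_germ (Z : VF R n) := exists2 r : R, 0 < r & smooth_field_on (@nball R n r) Z.

Lemma near0P (P : 'rV[R]_n -> Prop) :
  (\forall x \near (0 : 'rV[R]_n), P x) <-> exists2 r : R, 0 < r & forall x, `|x| < r -> P x.
Proof.
split.
  move=> /nbhs_ballP[r /= r0 H]; exists r => // x xr; apply: H.
  by rewrite -ball_normE /ball_/= sub0r normrN.
move=> [r r0 H]; apply/nbhs_ballP; exists r => //= x.
by rewrite -ball_normE /ball_/= sub0r normrN; exact: H.
Qed.

Lemma near0W (P : 'rV[R]_n -> Prop) : (forall x, P x) -> \forall x \near (0 : 'rV[R]_n), P x.
Proof. by move=> H; apply/near0P; exists 1. Qed.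

Lemma near0S (P Q : 'rV[R]_n -> Prop) : (forall x, P x -> Q x) ->
  (\forall x \near (0 : 'rV[R]_n), P x) -> \forall x \near (0 : 'rV[R]_n), Q x.
Proof. by move=> PQ /near0P[r r0 H]; apply/near0P; exists r => // x /H /PQ. Qed.

Lemma near0S2 (P Q P' : 'rV[R]_n -> Prop) : (forall x, P x -> Q x -> P' x) ->
  (\forall x \near (0 : 'rV[R]_n), P x) -> (\forall x \near (0 : 'rV[R]_n), Q x) ->
  \forall x \near (0 : 'rV[R]_n), P' x.
Proof.
move=> H /near0P[r1 r10 H1] /near0P[r2 r20 H2]; apply/near0P.
exists (Num.min r1 r2); first by rewrite lt_min r10.
by move=> x; rewrite lt_min => /andP[/H1 a /H2 b]; exact: H.
Qed.

Lemma smooth_germ_lie Z1 Z2 : smooth_germ Z1 -> smooth_germ Z2 -> smooth_germ (lie Z1 Z2).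
Proof.
move=> [r1 r10 S1] [r2 r20 S2]; exists (Num.min r1 r2); first by rewrite lt_min r10.
by apply: lie_smooth; [apply: smooth_field_on_le S1|apply: smooth_field_on_le S2]; rewrite ge_min lexx ?orbT.
Qed.

Lemma graded_bracket_smooth_germ X S Z a : (forall a, (0 < mi_abs a)%N -> smooth_germ (X a)) -> graded_bracket X S Z a -> smooth_germ Z.
Proof.
move=> HX; elim=> {Z a} [a a0 _|Z1 a1 Z2 a2 _ g1 _ g2]; first exact: HX.
exact: smooth_germ_lie.
Qed.

(** What the comparison of coefficients requires of a graded span; it lets one argument serve for
    the spans of the [Xh] and of the Taylor coefficients. *)
Definition closed_family (Q : VF R n -> mindex N -> Prop) :=
  [/\ forall a, Q (fun=> 0) a,
      forall Z Z' a, Q Z a -> Q Z' a -> Q (fun x => Z x + Z' x) a,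
      forall c Z a, Q Z a -> Q (fun x => c *: Z x) a,
      forall Z Z' a, Q Z a -> (\forall x \near (0 : 'rV[R]_n), Z x = Z' x) -> Q Z' a &
      forall Z1 a1 Z2 a2, Q Z1 a1 -> Q Z2 a2 -> Q (lie Z1 Z2) (madd a1 a2)].

Lemma closed_sum Q (I : Type) (s : seq I) (P : pred I) (F : I -> VF R n) a :
  closed_family Q -> (forall i, P i -> Q (F i) a) -> Q (fun x => \sum_(i <- s | P i) F i x) a.
Proof.
move=> [Q0 QD _ Qe _] H; elim: s => [|i s IH].
  by apply: Qe (Q0 a) _; apply: near0W => x; rewrite big_nil.
case Pi: (P i); last first.
  by apply: Qe IH _; apply: near0W => x; rewrite big_cons Pi.
by apply: Qe (QD _ _ _ (H i Pi) IH) _; apply: near0W => x; rewrite big_cons Pi.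
Qed.

(** Bilinearity of the bracket for germs. Differentiating a combination requires all its fields to
    be smooth on a common ball, hence the smallest of finitely many radii. *)
Lemma lie_comb k (c : 'I_k -> R) (Zs : 'I_k -> VF R n) l (d : 'I_l -> R) (Ws : 'I_l -> VF R n)
    (Z W : VF R n) :
  (forall j, smooth_germ (Zs j)) -> (forall j, smooth_germ (Ws j)) ->
  (\forall x \near (0 : 'rV[R]_n), Z x = \sum_j c j *: Zs j x) ->
  (\forall x \near (0 : 'rV[R]_n), W x = \sum_j d j *: Ws j x) ->
  \forall x \near (0 : 'rV[R]_n),
    \sum_i \sum_j (c i * d j) *: lie (Zs i) (Ws j) x = lie Z W x.
Proof.
move=> gZ gW /near0P[r1 r10 EZ] /near0P[r2 r20 EW].
have HZ j : exists r : R, 0 < r /\ smooth_field_on (@nball R n r) (Zs j).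
  by have [r r0 Sr] := gZ j; exists r.
have HW j : exists r : R, 0 < r /\ smooth_field_on (@nball R n r) (Ws j).
  by have [r r0 Sr] := gW j; exists r.
have [rZ {}HZ] := choice HZ; have [rW {}HW] := choice HW.
have [r3 r30 H3] := @fin_min R 'I_k rZ (fun j => (HZ j).1).
have [r4 r40 H4] := @fin_min R 'I_l rW (fun j => (HW j).1).
pose r := Num.min (Num.min r1 r2) (Num.min r3 r4).
have [l1 l2 l3 l4] : [/\ r <= r1, r <= r2, r <= r3 & r <= r4].
  by rewrite /r; split; rewrite !ge_min lexx ?orbT.
have Uo := @open_nball R n r.
have SZ j : smooth_field_on (@nball R n r) (Zs j) by apply: smooth_field_on_le (HZ j).2; exact: le_trans (H3 j).
have SW j : smooth_field_on (@nball R n r) (Ws j) by apply: smooth_field_on_le (HW j).2; exact: le_trans (H4 j).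
have EZi i x : @nball R n r x -> Z x 0 i = \sum_j c j * Zs j x 0 i.
  move=> Ux; rewrite EZ ?summxE; last exact: lt_le_trans Ux l1.
  by apply: eq_bigr => j _; rewrite mxE.
have EWi i x : @nball R n r x -> W x 0 i = \sum_j d j * Ws j x 0 i.
  move=> Ux; rewrite EW ?summxE; last exact: lt_le_trans Ux l2.
  by apply: eq_bigr => j _; rewrite mxE.
have SZ' : smooth_field_on (@nball R n r) Z.
  move=> i; apply: (smooth_on_eq Uo (f := fun x => \sum_j c j * Zs j x 0 i)).
    by move=> x Ux; rewrite EZi.
  exact: (smooth_on_sum Uo (fun j => smooth_on_scale Uo (c j) (SZ j i))).
have SW' : smooth_field_on (@nball R n r) W.
  move=> i; apply: (smooth_on_eq Uo (f := fun x => \sum_j d j * Ws j x 0 i)).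
    by move=> x Ux; rewrite EWi.
  exact: (smooth_on_sum Uo (fun j => smooth_on_scale Uo (d j) (SW j i))).
have DZ f x : @nball R n r x -> lie_derivative r Z f x = \sum_i c i * lie_derivative r (Zs i) f x.
  move=> Ux; rewrite lie_derivativeE //.
  under eq_bigr do rewrite EZi // mulr_suml.
  rewrite exchange_big /=; apply: eq_bigr => i _; rewrite lie_derivativeE // mulr_sumr.
  by apply: eq_bigr => j _; rewrite mulrA.
have DW f x : @nball R n r x -> lie_derivative r W f x = \sum_i d i * lie_derivative r (Ws i) f x.
  move=> Ux; rewrite lie_derivativeE //.
  under eq_bigr do rewrite EWi // mulr_suml.
  rewrite exchange_big /=; apply: eq_bigr => i _; rewrite lie_derivativeE // mulr_sumr.
  by apply: eq_bigr => j _; rewrite mulrA.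
apply/near0P; exists r; first by rewrite !lt_min r10 r20 r30.
move=> x Ux; apply/rowP => i; rewrite (lie_coord i SZ' SW' Ux).
rewrite (lie_derivative_eq Z (EWi i)) (lie_derivative_eq W (EZi i)) DZ // DW //.
rewrite (eq_bigr (fun k0 => \sum_j (c k0 * d j) * lie_derivative r (Zs k0) (fun x => Ws j x 0 i) x)); last first.
  move=> j _; rewrite (@lie_derivative_sum R n r (Zs j) _ d (fun j x => Ws j x 0 i)) // ?mulr_sumr.
    by apply: eq_bigr => j' _; rewrite mulrA.
  by move=> j'; exact: SW.
rewrite [X in _ = _ - X](eq_bigr (fun k0 => \sum_j (d k0 * c j) * lie_derivative r (Ws k0) (fun x => Zs j x 0 i) x)); last first.
  move=> j _; rewrite (@lie_derivative_sum R n r (Ws j) _ c (fun j x => Zs j x 0 i)) // ?mulr_sumr.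
    by apply: eq_bigr => j' _; rewrite mulrA.
  by move=> j'; exact: SZ.
rewrite [X in _ = _ - X]exchange_big /= -sumrB summxE; apply: eq_bigr => j _.
rewrite summxE -sumrB; apply: eq_bigr => j' _.
by rewrite mxE (lie_coord i (SZ j) (SW j') Ux) mulrBr [d j' * _]mulrC.
Qed.

Lemma graded_span_scale_graded_bracket X S c Z a : graded_bracket X S Z a -> graded_span X S (fun x => c *: Z x) a.
Proof.
move=> LZ; exists 1%N, (fun=> c), (fun=> Z); split=> //; apply: near0W => x.
by rewrite big_ord1.
Qed.

Lemma graded_span_add X S Z Z' a : graded_span X S Z a -> graded_span X S Z' a ->
  graded_span X S (fun x => Z x + Z' x) a.
Proof.
move=> [k [c [Zs [L E]]]] [k' [c' [Zs' [L' E']]]].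
exists (k + k')%N, (fun j => match fintype.split j with inl i => c i | inr i => c' i end),
  (fun j => match fintype.split j with inl i => Zs i | inr i => Zs' i end); split.
  by move=> j; case: fintype.split.
apply: near0S2 E E' => x -> ->; rewrite big_split_ord /=; congr (_ + _).
  by apply: eq_bigr => i _; rewrite (unsplitK (inl i)).
by apply: eq_bigr => i _; rewrite (unsplitK (inr i)).
Qed.

Lemma graded_span_eq X S Z Z' a : graded_span X S Z a ->
  (\forall x \near (0 : 'rV[R]_n), Z x = Z' x) -> graded_span X S Z' a.
Proof.
move=> [k [c [Zs [L E]]]] ZZ'; exists k, c, Zs; split=> //.
by apply: near0S2 E ZZ' => x -> ->.
Qed.

Lemma graded_span_0 X S a : graded_span X S (fun=> 0) a.
Proof.
exists 0%N, (fun=> 0), (fun _ _ => 0); split; first by case.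
by apply: near0W => x; rewrite big_ord0.
Qed.

Lemma graded_span_sum X S (I : Type) (s : seq I) (F : I -> VF R n) a :
  (forall i, graded_span X S (F i) a) -> graded_span X S (fun x => \sum_(i <- s) F i x) a.
Proof.
move=> H; elim: s => [|i s IH].
  by apply: graded_span_eq (graded_span_0 X S a) _; apply: near0W => x; rewrite big_nil.
by apply: graded_span_eq (graded_span_add (H i) IH) _; apply: near0W => x; rewrite big_cons.
Qed.

Lemma graded_span_closed X S : (forall a, (0 < mi_abs a)%N -> smooth_germ (X a)) -> closed_family (graded_span X S).
Proof.
move=> HX; split.
- exact: graded_span_0.
- exact: graded_span_add.
- move=> c Z a [k [d [Zs [L E]]]]; exists k, (fun j => c * d j), Zs; split=> //.
  by apply: near0S E => x ->; rewrite scaler_sumr; apply: eq_bigr => j _; rewrite scalerA.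
- exact: graded_span_eq.
- move=> Z1 a1 Z2 a2 [k [c [Zs [L E]]]] [k' [c' [Zs' [L' E']]]].
  have gZ j : smooth_germ (Zs j) by exact: graded_bracket_smooth_germ (L j).
  have gZ' j : smooth_germ (Zs' j) by exact: graded_bracket_smooth_germ (L' j).
  apply: graded_span_eq (lie_comb gZ gZ' E E').
  apply: graded_span_sum => i; apply: graded_span_sum => j.
  by apply: graded_span_scale_graded_bracket; exact: graded_bracket_br.
Qed.

(** Reduces everything to the generators: since spans are stable under brackets, replacing each
    generator by a combination of the same index is enough. *)
Lemma graded_bracket_transfer X X' S Z a :
  (forall a, (0 < mi_abs a)%N -> smooth_germ (X' a)) ->
  (forall a, (0 < mi_abs a)%N -> S a -> graded_span X' S (X a) a) ->
  graded_bracket X S Z a -> graded_span X' S Z a.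
Proof.
move=> HX' H; elim=> {Z a} [a a0 Sa|Z1 a1 Z2 a2 _ s1 _ s2]; first exact: H.
by have [_ _ _ _ Ql] := graded_span_closed S HX'; exact: Ql.
Qed.

Definition hereditary S := forall a b, S (madd a b) ->
  (0 < mi_abs a)%N -> (0 < mi_abs b)%N -> S a /\ S b.

(** A member with q = 0 is a multiple of some [Xh b], so its index must be shorter than m. For q > 0
    the index splits into at least two nonzero parts, each shorter than m, so a bracket of total
    length m is still allowed. *)
Lemma ad_family_family (Q : VF R n -> mindex N -> Prop) S (Xh : mindex N -> VF R n) M m :
  closed_family Q -> hereditary S ->
  (forall b, (0 < mi_abs b < m)%N -> S b -> Q (Xh b) b) ->
  forall q (j : ix (ad_family (exp_family Xh M) q)), S (ex j) -> (mi_abs (ex j) <= m)%N ->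
  (0 < q)%N || (mi_abs (ex j) < m)%N -> Q (va j) (ex j).
Proof.
move=> [Q0 QD Qs Qe Ql] hS H; elim=> [|q IH] j.
  move=> Sj jm /= jm'; apply: Qs; apply: H => //.
  by rewrite jm' andbT; exact: (order_exp_family j).
case: j => j i /= Sj jm _.
have j0 : (0 < mi_abs (ex j))%N.
  by apply: leq_trans (order_ad_family (@order_exp_family R N n Xh M) j).
have i0 : (0 < mi_abs (ex i))%N by exact: order_exp_family.
rewrite mi_abs_madd in jm.
have [Sj' Si] := hS _ _ Sj j0 i0.
apply: Ql.
  apply: IH => //; first by apply: leq_trans jm; exact: leq_addr.
  (* The factor coming from Y has a nonzero index, so what remains is strictly shorter than m, even
     when it is an unbracketed term. *)
  by apply/orP; right; apply: leq_trans jm; rewrite -[ltnLHS]addn0 ltn_add2l.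
apply: H => //; rewrite i0 /=; apply: leq_trans jm.
by rewrite -[ltnLHS]add0n ltn_add2r.
Qed.
End Spans.

(** * The triangular relation between the two families of coefficients *)

Section Relation.
Variables (R : realType) (N n : nat).
Variables (gam W : 'rV[R]_N -> 'rV[R]_n -> 'rV[R]_n) (Xh : mindex N -> VF R n).
Hypothesis Sgam : smooth_near (unc gam) 0.
Hypothesis gam0 : \forall x \near (0 : 'rV[R]_n), gam 0 x = x.
Hypothesis HW : is_W gam W.
Hypothesis HX : is_exp_coefs gam Xh.

Lemma smooth_germ_Xh a : smooth_germ (Xh a).
Proof. by have [r r0 [S _]] := smooth_near_field (HX.1 a); exists r. Qed.

(** Gathers one radius valid for all data up to order M. It may shrink as M grows, which is harmless
    for identities between germs at 0. *)
Lemma relation M alpha : (mi_abs alpha < M)%N -> exists2 c : R, 0 < c &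
  \forall x \near (0 : 'rV[R]_n), c *: taylor_coef W alpha x =
   \sum_(q < M) (q.+1`!%:R^-1 : R) *:
     \sum_(j : ix (ad_family (exp_family Xh M) q) | ex j == alpha) va j x.
Proof.
move=> aM; have M0 : (0 < M)%N by exact: leq_ltn_trans aM.
have [r1 r10 [S1 _]] := smooth_near_field Sgam.
have [r2 r20 [S2 S2']] := smooth_near_field HW.1.
have [r3 r30 H3] := HW.2.
have /near0P[r4 r40 H4] := gam0.
have [r5 r50 [C C0 H5]] := HX.2 M.
have HrX (b : {ffun 'I_N -> 'I_M}) : exists r : R, 0 < r /\ smooth_field_on (@nball R n r) (Xh (fmi b)).
  by have [r r0 Sr] := smooth_germ_Xh (fmi b); exists r.
have [rX {}HrX] := choice HrX.
have [r6 r60 H6] := @fin_min R {ffun 'I_N -> 'I_M} rX (fun j => (HrX j).1).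
pose r := Num.min (Num.min r1 r2) (Num.min (Num.min r3 r4) (Num.min r5 r6)).
have [l1 l2 l3] : [/\ r <= r1, r <= r2 & r <= r3].
  by rewrite /r; split; rewrite !ge_min lexx ?orbT.
have [l4 l5 l6] : [/\ r <= r4, r <= r5 & r <= r6].
  by rewrite /r; split; rewrite !ge_min lexx ?orbT.
have r0 : 0 < r by rewrite !lt_min r10 r20 r30 r40 r50.
have A1 : smooth_family r (exp_family Xh M).
  by move=> [b Ab]; apply: smooth_field_on_le (HrX b).2; exact: le_trans (H6 b).
have A2 : smooth_field_on (@nball R (N + n) r) (unc W) by exact: smooth_field_on_le S2.
have A3 : smooth_field_on (@nball R (N + n) r) (unc gam) by exact: smooth_field_on_le S1.
have A4 x : `|x| < r -> gam 0 x = x by move=> xr; apply: H4; exact: lt_le_trans l4.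
have A5 t y : `|t| < r -> `|y| < r ->
    W t (gam t y) = derive (fun eps : R => gam (eps *: t) y) 1 1.
  by move=> tr yr; apply: H3; apply: lt_le_trans l3.
have A6 t z : `|t| < r -> `|z| < r -> exists y,
    flow1 (fieldF (exp_family Xh M) t) z y /\ `|gam t z - y| <= C * `|t| ^+ M.
  move=> tr zr; have [y [fl Hy]] := H5 t z (lt_le_trans tr l5) (lt_le_trans zr l5).
  by exists y; rewrite fieldF_exp_family.
have A7 s z i : `|z| < r -> iter_partial s (unc W) z 0 i = iter_partial s (W_coord W i) z.
  by move=> zr; apply: S2'; exact: lt_le_trans l2.
have [c c0 Hc] := key_relation r0 C0 M0 A1 A2 A3 A4 A5 A6 A7 aM.
exists c => //; apply/near0P; exists r => // x; exact: Hc.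
Qed.

Lemma smooth_germ_taylor a : smooth_germ (taylor_coef W a).
Proof.
have [r r0 [S S']] := smooth_near_field HW.1; exists r => // i.
apply: (smooth_on_eq (@open_nball R n r)
  (f := fun x => (mi_fact a)%:R^-1 * t_partial (W_coord W i) (mi_seq a) (row_mx 0 x))).
  by move=> x Ux; rewrite (@taylor_coef_coord R N n W r).
apply: (smooth_on_scale (@open_nball R n r)).
apply: (@smooth_on_affine R n (N + n) (@rshift N n) (fun x => row_mx 0 x) _ (@nball R (N + n) r)
   (t_partial (W_coord W i) (mi_seq a))).
- by move=> h j z; exact: row_mx_x.
- exact: row_mx_continuous.
- by move=> z zr; apply: norm_row_mx; rewrite ?normr0.
- exact: (smooth_on_iter _ (S i)).
Qed.

Variable S : mindex N -> Prop.
Hypothesis hS : hereditary S.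

Lemma taylor_in_span a : (0 < mi_abs a)%N -> S a -> graded_span Xh S (taylor_coef W a) a.
Proof.
move=> a0 Sa; have cl := @graded_span_closed R N n Xh S (fun a _ => smooth_germ_Xh a).
have [c c0 E] := @relation (mi_abs a).+1 a (ltnSn _).
have [_ _ Qs Qe _] := cl.
apply: (Qe (fun x => c^-1 *: (c *: taylor_coef W a x))); last first.
  by apply: near0W => x; rewrite scalerA mulVf ?scale1r // lt0r_neq0.
pose total x := \sum_(q < (mi_abs a).+1) (q.+1`!%:R^-1 : R) *:
  \sum_(j : ix (ad_family (exp_family Xh (mi_abs a).+1) q) | ex j == a) va j x.
apply: (Qs); apply: (Qe total); last by apply: near0S E => x ->.
apply: (closed_sum _ cl) => q _; apply: (Qs).
apply: (closed_sum _ cl) => j /eqP ja.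
suff : graded_span Xh S (va j) (ex j) by rewrite ja.
(* The bound |a| + 1 admits [Xh a] itself, which occurs in the q = 0 term. *)
apply: (@ad_family_family R N n _ S Xh _ (mi_abs a).+1) => //; rewrite ?ja // ?ltnSn ?orbT //.
by move=> b /andP[b0 _] Sb; apply: graded_span_eq (graded_span_scale_graded_bracket 1 (graded_bracket_base Xh b0 Sb)) _;
  apply: near0W => x; rewrite scale1r.
Qed.

(** The relation is triangular: the q = 0 term is |a| times [Xh a], invertible as |a| > 0, and the
    other terms bracket fields of strictly shorter index, known by induction. *)
Lemma exp_in_span a : (0 < mi_abs a)%N -> S a -> graded_span (taylor_coef W) S (Xh a) a.
Proof.
have cl := @graded_span_closed R N n (taylor_coef W) S (fun a _ => smooth_germ_taylor a).
have [_ QD Qs Qe _] := cl.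
have [m] := ubnP (mi_abs a); elim: m a => // m IH a am a0 Sa.
have [c c0 E] := @relation (mi_abs a).+1 a (ltnSn _).
(* The terms with q >= 1, re-indexed from 0; hence the factorial of q + 2. *)
pose rest x := \sum_(q < mi_abs a) (q.+2`!%:R^-1 : R) *:
  \sum_(j : ix (ad_family (exp_family Xh (mi_abs a).+1) q.+1) | ex j == a) va j x.
have Qrest : graded_span (taylor_coef W) S rest a.
  apply: (closed_sum _ cl) => q _; apply: (Qs).
  apply: (closed_sum _ cl) => j /eqP ja.
  suff : graded_span (taylor_coef W) S (va j) (ex j) by rewrite ja.
  apply: (@ad_family_family R N n _ S Xh _ (mi_abs a)) => //; rewrite ?ja // => b /andP[b0 ba] Sb.
  by apply: IH => //; exact: leq_trans ba _.
(* Every component of a is at most |a|, so a lies in the box of the truncated family and is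
   represented there by exactly one element. *)
have afm i : (a i < (mi_abs a).+1)%N by rewrite ltnS /mi_abs (bigD1 i) //= leq_addr.
pose b0 : {ffun 'I_N -> 'I_(mi_abs a).+1} := [ffun i => Ordinal (afm i)].
have fb0 : fmi b0 = a by apply/ffunP => i; rewrite !ffunE.
have Ab0 : b0 \in @boxA N (mi_abs a).+1 by rewrite inE fb0 a0 ltnSn.
have first x : \sum_(j : ix (ad_family (exp_family Xh (mi_abs a).+1) 0) | ex j == a) va j x =
    (mi_abs a)%:R *: Xh a x.
  rewrite /= (bigD1 (Sub b0 Ab0)) /=; last by rewrite fb0.
  rewrite fb0 [X in _ + X]big_pred0 ?addr0 // => -[b Ab] /=.
  apply/negbTE/negP => /andP[/eqP fb /eqP]; apply; apply/val_inj => /=.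
  apply/ffunP => i; apply/val_inj => /=.
  by have := congr1 (fun f : mindex N => f i) fb; rewrite /= !ffunE.
apply: (Qe (fun x => (mi_abs a)%:R^-1 *: (c *: taylor_coef W a x + (-1) *: rest x))).
  apply: (Qs); apply: QD; apply: (Qs) => //.
  by apply: graded_span_eq (graded_span_scale_graded_bracket 1 (graded_bracket_base (taylor_coef W) a0 Sa)) _;
    apply: near0W => x; rewrite scale1r.
apply: near0S E => x ->; rewrite big_ord_recl /= invr1 scale1r first scaleN1r addrK.
by rewrite scalerA mulVf ?scale1r // pnatr_eq0 -lt0n.
Qed.
End Relation.

(** * Degrees and purity *)

Section Degrees.
Variables (R : realType) (N n nu : nat) (e : 'I_N -> 'rV[R]_nu).

Lemma deg_madd a b : deg e (madd a b) = deg e a + deg e b.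
Proof.
by rewrite /deg -big_split /=; apply: eq_bigr => i _; rewrite ffunE natrD scalerDl.
Qed.

(** Every nonzero index is pure or nonpure, so the union imposes no condition on indices. A degree
    is witnessed by some multi-index, obtained by adding those of the generators. *)
Lemma Lgen_graded_PN (X : mindex N -> VF R n) Z d : Lgen (PNset e X) Z d <->
  exists2 a, graded_bracket X (fun=> True) Z a & d = deg e a :> 'rV[R]_nu.
Proof.
split.
  elim=> {Z d} [Z d|Z1 d1 Z2 d2 _ [a1 L1 ->] _ [a2 L2 ->]].
    by case=> -[a [a0 _ -> ->]]; exists a => //; exact: graded_bracket_base.
  by exists (madd a1 a2); [exact: graded_bracket_br|rewrite deg_madd].
move=> [a L ->]; elim: L => {Z d a} [a a0 _|Z1 a1 Z2 a2 _ L1 _ L2].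
  apply: Lgen_base; case Pa: (pure e a); [left|right]; exists a; split=> //.
  by rewrite Pa.
by rewrite deg_madd; exact: Lgen_br.
Qed.

Lemma Lgen_graded_P (X : mindex N -> VF R n) Z d : Lgen (Pset e X) Z d <->
  exists2 a, graded_bracket X (fun a => pure e a) Z a & d = deg e a :> 'rV[R]_nu.
Proof.
split.
  elim=> {Z d} [Z d|Z1 d1 Z2 d2 _ [a1 L1 ->] _ [a2 L2 ->]].
    by case=> a [a0 pa -> ->]; exists a => //; exact: graded_bracket_base.
  by exists (madd a1 a2); [exact: graded_bracket_br|rewrite deg_madd].
move=> [a L ->]; elim: L => {Z d a} [a a0 pa|Z1 a1 Z2 a2 _ L1 _ L2].
  by apply: Lgen_base; exists a.
by rewrite deg_madd; exact: Lgen_br.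
Qed.

Hypothesis e0 : forall i mu, 0 <= e i 0 mu.
Hypothesis e1 : forall i, e i != 0.

Lemma deg_ge0 a mu : 0 <= deg e a 0 mu.
Proof.
by rewrite /deg summxE sumr_ge0 // => i _; rewrite mxE mulr_ge0.
Qed.

(** With nonnegative components no cancellation occurs, so any e_i present in the sum leaves a
    positive component. *)
Lemma deg_neq0 a : (0 < mi_abs a)%N -> exists mu, deg e a 0 mu != 0.
Proof.
move=> a0.
have [i ai] : exists i, (0 < a i)%N.
  apply/existsP; apply: contraLR a0; rewrite negb_exists => /forallP H.
  by rewrite -leqNgt leqn0 /mi_abs sum_nat_eq0; apply/forallP => i; have := H i; rewrite lt0n negbK.
have [mu emu] : exists mu, e i 0 mu != 0.
  apply/existsP; apply: contraNT (e1 i); rewrite negb_exists => /forallP H.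
  by apply/eqP/rowP => mu; have := H mu; rewrite negbK mxE => /eqP.
exists mu; rewrite gt_eqF // /deg summxE (bigD1 i) //= ltr_wpDr //.
  by apply: sumr_ge0 => j _; rewrite mxE mulr_ge0.
by rewrite mxE mulr_gt0 ?ltr0n // lt_neqAle eq_sym emu e0.
Qed.

(** By nonnegativity the support of deg a is contained in that of deg (a + b), a single component,
    and it is not empty when a is nonzero. *)
Lemma pure_hereditary : hereditary (fun a => pure e a).
Proof.
have H a b : pure e (madd a b) -> (0 < mi_abs a)%N -> pure e a.
  rewrite /pure => /eqP p1 /deg_neq0[mu Hmu]; rewrite eqn_leq; apply/andP; split.
    apply: (leq_trans _ (eq_leq p1)); apply: subset_leq_card; apply/fintype.subsetP => k /set_mem /= dk; apply/mem_set => /=.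
    rewrite deg_madd mxE gt_eqF // ltr_wpDr ?deg_ge0 //.
    by rewrite lt_neqAle eq_sym dk deg_ge0.
  by apply/card_gt0P; exists mu; apply/mem_set.
move=> a b pab a0 b0; split; first exact: H pab a0.
apply: (H b a) => //; suff -> : madd b a = madd a b by [].
by apply/ffunP => i; rewrite !ffunE addnC.
Qed.
End Degrees.

Theorem theorem7p8 (R : realType) (N n nu : nat) (e : 'I_N -> 'rV[R]_nu)
  (gam W : 'rV[R]_N -> 'rV[R]_n -> 'rV[R]_n) (Xh : mindex N -> VF R n) :
  (forall i mu, 0 <= e i 0 mu) ->
  (forall i, e i != 0) ->
  (forall mu, exists i, e i 0 mu != 0) ->
  smooth_near (unc gam) 0 ->
  (\forall x \near (0 : 'rV[R]_n), gam 0 x = x) ->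
  is_W gam W ->
  is_exp_coefs gam Xh ->
  [/\ (forall Z d, Lgen (PNset e (taylor_coef W)) Z d ->
                   in_span_deg (Lgen (PNset e Xh)) Z d),
      (forall Z d, Lgen (Pset e (taylor_coef W)) Z d ->
                   in_span_deg (Lgen (Pset e Xh)) Z d),
      (forall Z d, Lgen (PNset e Xh) Z d ->
                   in_span_deg (Lgen (PNset e (taylor_coef W))) Z d) &
      (forall Z d, Lgen (Pset e Xh) Z d ->
                   in_span_deg (Lgen (Pset e (taylor_coef W))) Z d)].
Proof.
move=> e0 e1 _ Sg g0 HW HX.
(* All four inclusions are one transfer of generators, with S everything or S the pure indices.
   Coefficients found for a multi-index are kept, and the label a is then read as deg a. *)
have hT : hereditary (fun _ : mindex N => True) by [].
have hP := pure_hereditary e0 e1.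
have gX a (_ : (0 < mi_abs a)%N) := smooth_germ_Xh HX a.
have gT a (_ : (0 < mi_abs a)%N) := smooth_germ_taylor HW a.
split=> Z d.
- move/Lgen_graded_PN => [a L ->].
  have [k [c [Zs [LZ E]]]] := graded_bracket_transfer gX (taylor_in_span Sg g0 HW HX hT) L.
  by exists k, c, Zs; split=> // j; apply/Lgen_graded_PN; exists a.
- move/Lgen_graded_P => [a L ->].
  have [k [c [Zs [LZ E]]]] := graded_bracket_transfer gX (taylor_in_span Sg g0 HW HX hP) L.
  by exists k, c, Zs; split=> // j; apply/Lgen_graded_P; exists a.
- move/Lgen_graded_PN => [a L ->].
  have [k [c [Zs [LZ E]]]] := graded_bracket_transfer gT (exp_in_span Sg g0 HW HX hT) L.
  by exists k, c, Zs; split=> // j; apply/Lgen_graded_PN; exists a.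
- move/Lgen_graded_P => [a L ->].
  have [k [c [Zs [LZ E]]]] := graded_bracket_transfer gT (exp_in_span Sg g0 HW HX hP) L.
  by exists k, c, Zs; split=> // j; apply/Lgen_graded_P; exists a.
Qed.
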